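(* Let $K\ge 15.71$ be a real number, and for $n\ge 1$ let $a_n=[n(\log n)^K]$, where $[\cdot]$ denotes the integer part. Then the sequence $(a_n)_{n\ge1}$ has metric Poissonian pair correlation; that is, for almost all $\alpha\in\mathbb{R}$ (with respect to Lebesgue measure), for every $s>0$, $$R_2(s,\alpha,N)\to 2s\quad\text{as } N\to\infty.$$
   Context: For real $x$, $\|x\|=\inf_{k\in\mathbb{Z}}|x+k|$ is the distance to the nearest integer. For a sequence $(a_n)_{n\ge1}$ of non-negative integers, real $s>0$, $\alpha\in\mathbb{R}$ and $N\in\mathbb{N}$, the pair correlation function of the sequence of fractional parts $(\{a_n\alpha\})_n$ is $$R_2(s,\alpha,N)=\frac1N\#\{(n,m)\in\mathbb{N}^2 : 1\le n,m\le N,\ n\ne m,\ \|a_n\alpha-a_m\alpha\|\le s/N\}.$$ *)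

(* Defs.v *)
From HB Require Import structures.
From mathcomp Require Import all_boot all_order all_algebra.
From mathcomp Require Import all_classical all_reals all_analysis.

Set Implicit Arguments.
Unset Strict Implicit.
Unset Printing Implicit Defensive.

Import Order.TTheory GRing.Theory Num.Theory.
Import numFieldNormedType.Exports.

Local Open Scope classical_set_scope.
Local Open Scope ring_scope.

Definition dist_int (R : realType) (x : R) : R :=
  inf [set `|x + k%:~R| | k in [set: int]].

(* A sequence indexed by n >= 1 is a function on nat whose value at 0 is never
   used. For N = 0 the value is the junk 0^-1 * 0 = 0, irrelevant in the limit. *)
Definition pair_correlation (R : realType) (a : nat -> nat)
    (s alpha : R) (N : nat) : R :=
  N%:R^-1 *
  #|[pred p : 'I_N.+1 * 'I_N.+1 |
      [&& (1 <= p.1)%N, (1 <= p.2)%N, p.1 != p.2 &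
          dist_int ((a p.1)%:R * alpha - (a p.2)%:R * alpha) <= s / N%:R]]|%:R.

Definition metric_poissonian_pair_correlation (R : realType)
    (a : nat -> nat) : Prop :=
  {ae @lebesgue_measure R, forall alpha : R, forall s : R, 0 < s ->
    pair_correlation a s alpha N @[N --> \oo] --> 2 * s}.

(* For n >= 1 the argument of Num.truncn is nonnegative, so this is the usual
   integer part; the value at n = 1 is 0 when K != 0, since powR 0 K = 0. *)
Definition n_log_pow (R : realType) (K : R) (n : nat) : nat :=
  Num.truncn (n%:R * (ln (n%:R : R)) `^ K).

(* Main.v *)
(* Write [f x = x (ln x)^K], so that [a_n] is the integer part of [f n]. The
   idea is a variance bound. For two frequencies [u], [v] the events
   [||u x|| <= e], [||v x|| <= e] on the circle have covariance at most
   [2 e gcd(u, v) / max(u, v)], by averaging over the rotations by [i / u].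
   If every difference [v] is attained by at most [B] pairs of indices up to
   [N], the variance of the pair correlation is therefore at most
   [O(s B^2 V log V / N^3)] with [V = a_N ~ N (log N)^K], and everything
   reduces to showing [B = O(N / (log N)^(K - 3))]: then the variance is
   [O((log N)^(7 - K))], hence summable along a subsequence of [N] growing like
   [exp (sqrt j)], whose consecutive ratios tend to 1.
   To bound [B], the pairs [(x, y)] with [a_y - a_x = v] are integer points near
   a curve. Two successive ones are mostly at a small vector [(p, q)], [q <= p],
   from each other. If [q = p], then [y - x = h] is unchanged, and convexity of
   [f] confines all [x] with this [h] to an interval of length
   [O(N / (h (log N)^(K - 1)))]. If [q = p - j < p], then [q f'(y) - p f'(x)] is
   bounded, and since [f''/f'] decreases this quantity is decreasing along the
   curve at a rate at least [j f''], which confines [x] to an interval of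
   length [O(N / (j (log N)^(K - 1)))] in which such points are [p]-separated. *)
From mathcomp Require Import all_boot all_order all_algebra.
From mathcomp Require Import zify ring lra.
From mathcomp Require Import all_classical all_reals all_analysis.
From mathcomp Require Import measurable_realfun.
Require Import Defs.

Set Implicit Arguments.
Unset Strict Implicit.
Unset Printing Implicit Defensive.

Import Order.TTheory GRing.Theory Num.Theory.
Import numFieldNormedType.Exports.

Local Open Scope classical_set_scope.
Local Open Scope ring_scope.

(** * Harmonic and gcd sums *)

(** Send [x] to the quotient by [p] of its distance to the least point [m] of [P]. Separation makes
    this injective, and the quotients do not exceed [B %/ p]. *)
Lemma card_separated (n p B : nat) (P : pred nat) : (0 < p)%N ->
  (forall x y, P x -> P y -> (x < y)%N -> (p <= y - x <= B)%N) ->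
  (#|[pred x : 'I_n | P x]| <= (B %/ p).+1)%N.
Proof.
move=> p0 sep.
have [[x0 Px0]|noP] := pselect (exists x, P x); last first.
  rewrite eq_card0 // => x; rewrite inE; apply/negP => Px.
  by apply: noP; exists x.
have exP : exists x, P x by exists x0.
case: (ex_minnP exP) => m Pm minm.
pose g (x : 'I_n) : 'I_(B %/ p).+1 := inord ((x - m) %/ p).
have gE (x : 'I_n) : P x -> nat_of_ord (g x) = ((x - m) %/ p)%N.
  move=> Px; rewrite /g inordK // ltnS leq_div2r //.
  have := minm _ Px; rewrite leq_eqVlt => /predU1P[->|mx]; first by rewrite subnn.
  by case/andP: (sep _ _ Pm Px mx).
rewrite -[X in (_ <= X)%N]card_ord -(card_in_image (f := g)) ?max_card //.
have aux (x y : 'I_n) : P x -> P y -> (x < y)%N -> g x <> g y.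
  move=> Px Py xy /(congr1 (@nat_of_ord _)); rewrite !gE // => e.
  have mx := minm _ Px.
  have /andP[pxy _] := sep _ _ Px Py xy.
  have : ((x - m) %/ p + 1 <= (y - m) %/ p)%N.
    rewrite -(divnDMl _ _ p0) mul1n; apply: leq_div2r.
    lia.
  by rewrite -e; lia.
move=> x y; rewrite !inE => Px Py gxy.
have [xy|yx|/val_inj//] := ltngtP x y.
  by case: (aux _ _ Px Py xy).
by case: (aux _ _ Py Px yx).
Qed.

Section harmonic.
Variable R : realType.

Definition harm (n : nat) : R := \sum_(1 <= i < n.+1) i%:R^-1.

Lemma harm_ge0 n : 0 <= harm n.
Proof. by apply: sumr_ge0 => i _; rewrite invr_ge0. Qed.

Lemma harm_le m n : (m <= n)%N -> harm m <= harm n.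
Proof.
move=> mn; rewrite /harm [leRHS](@big_cat_nat _ _ _ m.+1) //=.
by rewrite lerDl; apply: sumr_ge0 => i _; rewrite invr_ge0.
Qed.

(** Induction; the step is [ln (1 - t) <= - t] with [t] the reciprocal of the new index. *)
Lemma harm_ln n : (0 < n)%N -> harm n <= 1 + ln n%:R.
Proof.
elim: n => // -[_ _|n IH _].
  by rewrite /harm big_nat1 invr1 ln1 addr0.
rewrite /harm big_nat_recr //=.
have -> : ln n.+2%:R = ln n.+1%:R + ln (n.+2%:R / n.+1%:R) :> R.
  by rewrite -lnM ?posrE ?divr_gt0 ?ltr0n // mulrC divfK // pnatr_eq0.
rewrite addrA lerD ?IH //.
have -> : n.+2%:R / n.+1%:R = (n.+1%:R / n.+2%:R)^-1 :> R.
  by rewrite invf_div.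
rewrite lnV ?posrE ?divr_gt0 ?ltr0n //.
have -> : n.+1%:R / n.+2%:R = 1 + (- n.+2%:R^-1) :> R.
  have x0 : 0 <= n.+1%:R :> R by [].
  rewrite [n.+2%:R]mulrS; move: x0; move: n.+1%:R => x x0.
  by field; rewrite gt_eqF //; lra.
rewrite lerNr; apply: le_ln1Dx.
by rewrite ltrN2 invf_lt1 ?ltr0n // ltr1n.
Qed.

Lemma sum_dvdn_ord d u : (0 < d)%N ->
  (\sum_(1 <= v < u.+1) (d %| v) = u %/ d)%N.
Proof.
move=> d0; elim: u => [|u IH]; first by rewrite big_nil div0n.
by rewrite big_nat_recr //= IH divnS // addnC.
Qed.

(** The term [d = gcdn u v] of the sum is enough. *)
Lemma gcdn_le_sum_dvdn u v n : (0 < u <= n)%N ->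
  (gcdn u v <= \sum_(1 <= d < n.+1) (d %| u) * (d %| v) * d)%N.
Proof.
move=> /andP[u0 un].
have g0 : (0 < gcdn u v)%N by rewrite gcdn_gt0 u0.
have gn : (gcdn u v <= n)%N by apply: leq_trans un; apply: dvdn_leq (dvdn_gcdl _ _).
rewrite (@big_cat_nat _ _ _ (gcdn u v)) //= ?leqW //.
rewrite [X in (_ <= _ + X)%N]big_ltn // dvdn_gcdl dvdn_gcdr.
by rewrite !mul1n addnCA leq_addr.
Qed.

(** After exchanging the sums, each divisor [d] of [u] contributes [d] for each of its [u / d]
    multiples up to [u], hence [u] in total. *)
Lemma sum_gcdn_le u n : (0 < u <= n)%N ->
  (\sum_(1 <= v < u.+1) gcdn u v <= u * \sum_(1 <= d < n.+1) (d %| u))%N.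
Proof.
move=> un.
apply: (@leq_trans (\sum_(1 <= v < u.+1) \sum_(1 <= d < n.+1) (d %| u) * (d %| v) * d)%N).
  by apply: leq_sum => v _; apply: gcdn_le_sum_dvdn.
rewrite exchange_big /= big_distrr /=.
rewrite [leqLHS]big_nat [leqRHS]big_nat; apply: leq_sum => d /andP[d0 _].
under eq_bigr do rewrite mulnAC.
rewrite -big_distrr /= sum_dvdn_ord //.
case: (boolP (d %| u)%N) => [/divnK|]; last by rewrite muln0.
by rewrite mul1n muln1 mulnC => ->.
Qed.

(** The inner sum is at most the number of divisors of [u]; summing this over [u] counts, for every
    [d], its at most [n / d] multiples. *)
Lemma sum_gcd_le n :
  \sum_(1 <= u < n.+1) \sum_(1 <= v < u.+1) (gcdn u v)%:R / u%:R <= n%:R * harm n.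
Proof.
apply: (@le_trans _ _ (\sum_(1 <= u < n.+1) (\sum_(1 <= d < n.+1) (d %| u))%:R)).
  rewrite !big_nat; apply: ler_sum => u un.
  rewrite -mulr_suml -natr_sum ler_pdivrMr ?ltr0n; last by case/andP: un.
  by rewrite -natrM ler_nat mulnC sum_gcdn_le.
rewrite -natr_sum exchange_big /= natr_sum /harm mulr_sumr !big_nat.
apply: ler_sum => d /andP[d0 _].
rewrite sum_dvdn_ord // ler_pdivlMr ?ltr0n //.
by rewrite -natrM ler_nat leq_divM.
Qed.

(** The two triangles [v <= u] and [u <= v] cover the square and carry equal sums by symmetry;
    counting the diagonal twice is harmless. *)
Lemma sum_gcd_max_le n :
  \sum_(1 <= u < n.+1) \sum_(1 <= v < n.+1) (gcdn u v)%:R / (maxn u v)%:R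
    <= 2 * (n%:R * harm n).
Proof.
pose F u v : R := (gcdn u v)%:R / (maxn u v)%:R.
apply: (@le_trans _ _
   (\sum_(1 <= u < n.+1) \sum_(1 <= v < n.+1) (F u v *+ (v <= u)%N + F v u *+ (u <= v)%N))).
  apply: ler_sum => u _; apply: ler_sum => v _.
  have F0 : 0 <= F v u by rewrite /F divr_ge0.
  have Fs : F u v = F v u by rewrite /F gcdnC maxnC.
  rewrite -/(F u v) Fs; case: (leqP v u) => vu; case: (leqP u v) => uv; rewrite ?mulr1n ?mulr0n;
    lra || lia.
have half : \sum_(1 <= u < n.+1) \sum_(1 <= v < n.+1) F u v *+ (v <= u)%N <= n%:R * harm n.
  apply: le_trans (sum_gcd_le n); rewrite !big_nat; apply: ler_sum => u /andP[u0 un].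
  rewrite (@big_cat_nat _ _ _ u.+1) //=.
  rewrite [X in _ + X]big1_seq ?addr0; last first.
    move=> v; rewrite mem_index_iota => /andP[_ /andP[uv _]].
    by rewrite leqNgt uv.
  rewrite !big_nat; apply: ler_sum => v /andP[_]; rewrite ltnS => vu.
  by rewrite vu mulr1n /F (maxn_idPl vu).
under eq_bigr do rewrite big_split.
rewrite big_split /= [X in _ + X]exchange_big /=.
by rewrite mulr_natl mulr2n; apply: lerD.
Qed.

End harmonic.

(** * Counting integer points through their gaps *)

Lemma card_pred_sum n (P : pred nat) :
  #|[pred x : 'I_n | P x]| = (\sum_(x < n) P x)%N.
Proof.
rewrite -sum1_card big_mkcond; apply: eq_bigr => x _.
by rewrite inE; case: (P x).
Qed.

Section gap_count.
Variables (R : realType) (N L : nat) (s : pred nat) (nu : nat -> nat) (c : R).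
(* The points [(x, nu x)], [s x], model the integer points near a curve of slope
   at most 1; [c] is a lower bound for [phi'], [phi = f']. *)
Hypothesis L0 : (0 < L)%N.
Hypothesis c0 : 0 < c.
Hypothesis s_nu : forall x, s x -> (x < nu x <= N)%N.
Hypothesis nu_gap : forall x p, s x -> s (x + p)%N -> (0 < p <= L)%N ->
  (nu x <= nu (x + p)%N <= nu x + p)%N.
Hypothesis parallel : forall x y h, s x -> s y -> (x < y)%N ->
  nu x = (x + h)%N -> nu y = (y + h)%N -> (y - x)%:R * (h%:R * c) <= 2.
Hypothesis chord : forall x y p j, s x -> s y -> (x < y)%N ->
  s (x + p)%N -> s (y + p)%N -> (0 < j <= p)%N -> (p <= L)%N ->
  (nu (x + p) + j = nu x + p)%N -> (nu (y + p) + j = nu y + p)%N ->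
  (y - x)%:R * (j%:R * c) <= 8.

Let gap p x := s x && s (x + p)%N && [forall i : 'I_p, (0 < i)%N ==> ~~ s (x + i)%N].
Let isolated x := s x && [forall i : 'I_L, ~~ s (x + i.+1)%N].
Let T1 h x := `[< exists2 p, (0 < p)%N & [/\ s x, s (x + p)%N, nu x = (x + h)%N &
                                 nu (x + p) = (x + p + h)%N] >].
Let T2 p j x := gap p x && (nu (x + p) + j == nu x + p)%N.

(** A point that is not isolated has a successor at some distance [p <= L], and by [nu_gap] its
    image advances by [p - j] with [0 <= j <= p]. If [j = 0] the offset [h = nu x - x] is kept,
    which gives [T1]; otherwise [T2 p j] holds. *)
Let cover x : (s x <= isolated x + \sum_(1 <= h < N.+1) T1 h x
   + \sum_(1 <= p < L.+1) \sum_(1 <= j < p.+1) T2 p j x)%N.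
Proof.
case sx: (s x) => //.
case: (boolP (isolated x)) => [//|].
rewrite /isolated sx /= negb_forall => /existsP[i0]; rewrite negbK => si0.
have exi : exists p, (0 < p)%N && s (x + p)%N by exists i0.+1.
case: (ex_minnP exi) => p /andP[p0 sp] minp.
have pL : (p <= L)%N by apply: leq_trans (minp i0.+1 _) (ltn_ord i0).
have /andP[xp xpp] := nu_gap sx sp (introT andP (conj p0 pL)).
have /andP[xnx nxN] := s_nu sx.
have [e|ne] := eqVneq (nu (x + p)) (nu x + p)%N.
  rewrite (@big_cat_nat _ _ _ (nu x - x)) //=; [|lia|lia].
  rewrite [X in (_ <= _ + (_ + X) + _)%N]big_ltn; last by lia.
  have -> : T1 (nu x - x)%N x = true.
    apply/asboolP; exists p => //; split => //; lia.
  lia.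
have gp : gap p x.
  rewrite /gap sx sp; apply/forallP => i; apply/implyP => i1.
  apply/negP => si; have := minp i; rewrite i1 si => /(_ isT).
  by rewrite leqNgt ltn_ord.
rewrite [X in (_ <= _ + X)%N](@big_cat_nat _ _ _ p) //=; last by lia.
rewrite [X in (_ <= _ + (_ + X))%N]big_ltn //.
rewrite [X in (_ <= _ + (_ + (X + _)))%N](@big_cat_nat _ _ _ (nu x + p - nu (x + p))) //=; [|lia|lia].
rewrite [X in (_ <= _ + (_ + (_ + X + _)))%N]big_ltn; last by lia.
have -> : T2 p (nu x + p - nu (x + p)) x = true.
  by rewrite /T2 gp /=; apply/eqP; lia.
lia.
Qed.

Let card_isolated : #|[pred x : 'I_N.+1 | isolated x]|%:R <= N%:R / L%:R + 1 :> R.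
Proof.
have : (#|[pred x : 'I_N.+1 | isolated x]| <= (N %/ L).+1)%N.
  apply: card_separated => // x y /andP[sx /forallP xP] /andP[sy _] xy.
  have /andP[ys yN] := s_nu sy.
  apply/andP; split; last by lia.
  rewrite leqNgt; apply/negP => yxL.
  have i0 : ((y - x).-1 < L)%N by lia.
  have := xP (Ordinal i0); rewrite /=.
  have -> : (x + (y - x).-1.+1 = y)%N by lia.
  by rewrite sy.

rewrite -(ler_nat R) => /le_trans; apply.
rewrite -natr1 lerD2r ler_pdivlMr ?ltr0n // -natrM ler_nat.
exact: leq_divM.
Qed.

Let card_T1 h : (0 < h)%N -> #|[pred x : 'I_N.+1 | T1 h x]|%:R <= 2 / c * h%:R^-1.
Proof.
move=> h0; pose B := Num.truncn (2 / c * h%:R^-1).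
have hc : 0 < h%:R * c by rewrite mulr_gt0 // ltr0n.
have B0 : 0 <= 2 / c * h%:R^-1 by rewrite !mulr_ge0 ?invr_ge0 // ltW.
have leB k : k%:R * (h%:R * c) <= 2 -> (k <= B)%N.
  move=> k2; rewrite /B truncn_ge_nat //.
  rewrite -mulrA -invfM ler_pdivlMr 1?mulrC //.
  by move: k2; rewrite (mulrC c) mulrC.
have [[x T1x]|noP] := pselect (exists x, T1 h x); last first.
  rewrite eq_card0 // => x; rewrite inE; apply/negP => Px.
  by apply: noP; exists x.
have Bpos : (0 < B)%N.
  move/asboolP: T1x => [p p0 [sx sp e e']].
  have xp : (x < x + p)%N by lia.
  have := leB _ (parallel sx sp xp e e'); rewrite addKn.
  exact: leq_trans p0.
(* Each point of [T1 h] has another point of offset [h] ahead of it, so two points of [T1 h] are at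
   distance at most [B - 1]. This removes the additive 1 from the count, which summed over all
   [h <= N] would contribute [N]. *)
have : (#|[pred x : 'I_N.+1 | T1 h x]| <= (B.-1 %/ 1).+1)%N.
  apply: card_separated => // a b /asboolP[p p0 [sa sap e1 e2]].
  move=> /asboolP[p' p0' [sb sbp e1' e2']] ab; rewrite subn_gt0 ab /=.
  have abp : (a < b + p')%N by lia.
  have := leB _ (parallel sa sbp abp e1 e2'); clearbody B; lia.
rewrite divn1 prednK // -(ler_nat R) => /le_trans; apply.
by rewrite /B truncn_le.
Qed.

(** Points with gap [p] are [p]-separated, and [chord] confines those with the same [p] and [j] to
    length [8 / (j c)]. The additive 1 is affordable here, since there are at most [L ^ 2] pairs
    [(p, j)]. *)
Let card_T2 p j : (0 < j <= p)%N -> (p <= L)%N ->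
  #|[pred x : 'I_N.+1 | T2 p j x]|%:R <= 8 / c * (p%:R^-1 * j%:R^-1) + 1.
Proof.
move=> jp pL; have /andP[j0 jlp] := jp.
have p0 : (0 < p)%N by lia.
pose B := Num.truncn (8 / c * j%:R^-1).
have hc : 0 < j%:R * c by rewrite mulr_gt0 // ltr0n.
have B0 : 0 <= 8 / c * j%:R^-1 by rewrite !mulr_ge0 ?invr_ge0 // ltW.
have leB k : k%:R * (j%:R * c) <= 8 -> (k <= B)%N.
  move=> k2; rewrite /B truncn_ge_nat //.
  rewrite -mulrA -invfM ler_pdivlMr 1?mulrC //.
  by move: k2; rewrite (mulrC c) mulrC.
have : (#|[pred x : 'I_N.+1 | T2 p j x]| <= (B %/ p).+1)%N.
  apply: card_separated => // a b.
  move=> /andP[/andP[/andP[sa sap] /forallP ga] /eqP ea].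
  move=> /andP[/andP[/andP[sb sbp] _] /eqP eb] ab.
  apply/andP; split; last by apply: leB; apply: (chord (p := p)).
  rewrite leqNgt; apply/negP => bap.
  have := ga (Ordinal bap); rewrite /= subn_gt0 ab /=.
  by rewrite subnKC ?sb // ltnW.
rewrite -(ler_nat R) => /le_trans; apply.
rewrite -natr1 lerD2r mulrCA ler_pdivlMl ?ltr0n // -natrM.
apply: le_trans (_ : B%:R <= _); last by rewrite /B truncn_le.
by rewrite ler_nat mulnC leq_divM.
Qed.

Lemma gap_count : #|[pred x : 'I_N.+1 | s x]|%:R <=
  N%:R / L%:R + 1 + 2 / c * harm R N + (8 / c * harm R L ^+ 2 + L%:R ^+ 2).
Proof.
have : (#|[pred x : 'I_N.+1 | s x]| <= #|[pred x : 'I_N.+1 | isolated x]|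
   + \sum_(1 <= h < N.+1) #|[pred x : 'I_N.+1 | T1 h x]|
   + \sum_(1 <= p < L.+1) \sum_(1 <= j < p.+1) #|[pred x : 'I_N.+1 | T2 p j x]|)%N.
  rewrite !card_pred_sum.
  under [X in (_ <= _ + X + _)%N]eq_bigr do rewrite card_pred_sum.
  under [X in (_ <= _ + X)%N]eq_bigr do under eq_bigr do rewrite card_pred_sum.
  rewrite [X in (_ <= _ + X + _)%N]exchange_big.
  under [X in (_ <= _ + X)%N]eq_bigr do rewrite exchange_big.
  rewrite [X in (_ <= _ + X)%N]exchange_big -!big_split.
  by apply: leq_sum => x _; exact: cover.
rewrite -(ler_nat R) => /le_trans; apply.
rewrite !natrD; apply: lerD; first apply: lerD => //.
  rewrite natr_sum /harm mulr_sumr !big_nat; apply: ler_sum => h /andP[h0 _].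
  exact: card_T1.
have c8 : 0 <= 8 / c by rewrite divr_ge0 // ltW.
rewrite natr_sum.
apply: (@le_trans _ _ (\sum_(1 <= p < L.+1) (8 / c * harm R L * p%:R^-1 + L%:R))); last first.
  rewrite big_split /= -mulr_sumr -/(harm R L) [in leRHS]expr2 [in leRHS]mulrA lerD2l.
  by rewrite sumr_const_nat subSS subn0 expr2 mulr_natr.
rewrite !big_nat; apply: ler_sum => p /andP[p0]; rewrite ltnS => pL.
rewrite natr_sum.
apply: (@le_trans _ _ (\sum_(1 <= j < p.+1) (8 / c * p%:R^-1 * j%:R^-1 + 1))).
  rewrite !big_nat; apply: ler_sum => j jp; rewrite -mulrA.
  exact: card_T2.
rewrite big_split /= -mulr_sumr -/(harm R p); apply: lerD.
  rewrite mulrAC ler_wpM2r ?invr_ge0 // ler_wpM2l //.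
  exact: harm_le.
by rewrite sumr_const_nat subSS subn0 ler_nat.
Qed.

End gap_count.

(** * Calculus of x (ln x)^K *)

Lemma mvt_cc (R : realType) (g dg : R -> R) (a b : R) : a <= b ->
  (forall x, a <= x <= b -> is_derive x 1 g (dg x)) ->
  exists2 x, a <= x <= b & g b - g a = dg x * (b - a).
Proof.
move=> ab dP.
have [//| |x] := @MVT_segment R g dg a b ab.
- by move=> x /subset_itv_oo_cc; rewrite in_itv /= => /dP.
- apply: derivable_within_continuous => x; rewrite in_itv /= => /dP ?.
  exact: ex_derive.
- by rewrite in_itv /=; exists x.
Qed.

Section n_log_pow_calculus.
Variables (R : realType) (K : R).

Definition nlp (x : R) : R := x * ln x `^ K.
Definition dnlp (x : R) : R := ln x `^ K + K * ln x `^ (K - 1).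
Definition ddnlp (x : R) : R := ln x `^ (K - 1) * (K * (1 + (K - 1) / ln x)) / x.

(** [ln] takes the default value 0 on nonpositive reals, so [1 <= ln x] serves as a single domain
    condition below: it implies [0 < x] and makes the powers of [ln x] nondecreasing in the
    exponent. *)
Lemma ge1_ln_gt0 (x : R) : 1 <= ln x -> 0 < x.
Proof. by move=> x1; rewrite ltNge; apply/negP => x0; move: x1; rewrite ln0 // ler10. Qed.

Lemma is_derive_nlp x : 1 <= ln x -> is_derive x 1 nlp (dnlp x).
Proof.
move=> x1; have x0 := ge1_ln_gt0 x1.
have l0 : 0 < ln x by lra.
have h1 := is_derive1_ln x0.
have h2 := is_derive1_powR K l0.
have h3 : is_derive x 1 (fun y => ln y `^ K) (K * ln x `^ (K - 1) * x^-1).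
  exact: (@is_derive1_comp R (fun t => t `^ K) (@ln R) x _ _ h2 h1).
rewrite /nlp; apply: is_derive_eq.
have xN : x != 0 by rewrite gt_eqF.
by rewrite /dnlp /GRing.scale /=; field.
Qed.

Lemma powR_pred (t p : R) : 0 < t -> t `^ (p - 1) = t `^ p / t.
Proof.
move=> t0; rewrite powRB; first by rewrite powRr1 // ltW.
by rewrite (gt_eqF t0) implybT.
Qed.

Lemma is_derive_dnlp x : 1 <= ln x -> is_derive x 1 dnlp (ddnlp x).
Proof.
move=> x1; have x0 := ge1_ln_gt0 x1.
have l0 : 0 < ln x by lra.
have h1 := is_derive1_ln x0.
have h2 p := is_derive1_powR p l0.
have h3 p : is_derive x 1 (fun y => ln y `^ p) (p * ln x `^ (p - 1) * x^-1).
  exact: (@is_derive1_comp R (fun t => t `^ p) (@ln R) x _ _ (h2 p) h1).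
rewrite /dnlp; apply: is_derive_eq.
rewrite /ddnlp /GRing.scale /= !(powR_pred _ l0).
have xN : x != 0 by rewrite gt_eqF.
have lN : ln x != 0 by rewrite gt_eqF.
by field; rewrite xN lN.
Qed.

Lemma ge1_ln_le (x y : R) : 1 <= ln x -> x <= y -> 1 <= ln y.
Proof.
move=> x1 xy; have x0 := ge1_ln_gt0 x1.
by apply: le_trans x1 _; rewrite ler_ln ?posrE // (lt_le_trans x0).
Qed.

Lemma ln_le (x y : R) : 1 <= ln x -> x <= y -> ln x <= ln y.
Proof.
move=> x1 xy; have x0 := ge1_ln_gt0 x1.
by rewrite ler_ln ?posrE // (lt_le_trans x0).
Qed.

Lemma ddnlp_ge x : 2 <= K -> 1 <= ln x -> ln x `^ (K - 1) / x <= ddnlp x.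
Proof.
move=> K2 x1; have x0 := ge1_ln_gt0 x1.
rewrite /ddnlp ler_wpM2r ?invr_ge0 ?(ltW x0) // ler_peMr ?powR_ge0 //.
have : 0 <= (K - 1) / ln x by apply: divr_ge0; lra.
by move: ((K - 1) / ln x) => w w0; nra.
Qed.

Lemma ddnlp_le x : 2 <= K -> 1 <= ln x -> ddnlp x <= K ^+ 2 * ln x `^ K / x.
Proof.
move=> K2 x1; have x0 := ge1_ln_gt0 x1.
rewrite /ddnlp ler_wpM2r ?invr_ge0 ?(ltW x0) //.
rewrite [leRHS]mulrC; apply: ler_pM; rewrite ?powR_ge0 //.
- have : 0 <= (K - 1) / ln x by apply: divr_ge0; lra.
  by move: ((K - 1) / ln x) => w w0; nra.
- by rewrite ler_powR //; lra.
- have : (K - 1) / ln x <= K - 1 by rewrite ler_pdivrMr; nra.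
  by move: ((K - 1) / ln x) => w w0; nra.
Qed.

(** Cross-multiplied monotonicity of [ddnlp / dnlp], which for [s = ln x] equals
    [K (s + K - 1) / (s (s + K) x)] and decreases in [x]. *)
Lemma ddnlp_ratio_le x y : 2 <= K -> 1 <= ln x -> x <= y ->
  ddnlp y * dnlp x <= ddnlp x * dnlp y.
Proof.
move=> K2 x1 xy; have x0 := ge1_ln_gt0 x1.
have y1 := ge1_ln_le x1 xy; have y0 := ge1_ln_gt0 y1.
have lxy := ln_le x1 xy.
rewrite /ddnlp /dnlp !powR_pred; [|lra..].
have px : 0 < ln x `^ K by apply: powR_gt0; lra.
have py : 0 < ln y `^ K by apply: powR_gt0; lra.
move: px py lxy x1 y1 xy x0 y0.
move: (ln x) (ln y) (ln x `^ K) (ln y `^ K) => s t p q p0 q0 st s1 t1 xy x0 y0.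
have dN : [/\ s != 0, t != 0, x != 0 & y != 0] by split; rewrite gt_eqF //; lra.
case: dN => sN tN xN yN.
have -> : q / t * (K * (1 + (K - 1) / t)) / y * (p + K * (p / s)) =
   (p * q * K) * ((t + K - 1) * (s + K) / (t ^+ 2 * s * y)).
  by field; rewrite sN tN yN.
have -> : p / s * (K * (1 + (K - 1) / s)) / x * (q + K * (q / t)) =
   (p * q * K) * ((s + K - 1) * (t + K) / (s ^+ 2 * t * x)).
  by field; rewrite sN tN xN.
apply: ler_wpM2l; first by rewrite !mulr_ge0 //; lra.
have sx0 : 0 < s by lra.
have tx0 : 0 < t by lra.
rewrite ler_pdivrMr ?mulr_gt0 ?exprn_gt0 // mulrAC ler_pdivlMr ?mulr_gt0 ?exprn_gt0 //.
have A : (t + K - 1) * (s + K) * s <= (s + K - 1) * (t + K) * t.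
  have : 0 <= (t - s) * (s * t + (K - 1) * (s + t) + K * (K - 1)).
    by apply: mulr_ge0; [lra|rewrite !addr_ge0 // ?mulr_ge0 //; lra].
  lra.
have B : 0 <= (t + K - 1) * (s + K) * s by rewrite !mulr_ge0 //; lra.
have st0 : 0 <= s * t by rewrite mulr_ge0 // ltW.
have := ler_pM B (ltW x0) A xy.
move=> /(ler_wpM2l st0).
set X := (X in X <= _ -> _); set Y := (Y in _ <= Y -> _).
have -> : (t + K - 1) * (s + K) * (s ^+ 2 * t * x) = X by rewrite /X; ring.
by have -> : (s + K - 1) * (t + K) * (t ^+ 2 * s * y) = Y by rewrite /Y; ring.
Qed.

Lemma dnlp_ge x : 2 <= K -> 1 <= ln x -> ln x `^ K <= dnlp x.
Proof.
by move=> K2 x1; rewrite /dnlp lerDl mulr_ge0 ?powR_ge0 //; lra.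
Qed.

Lemma dnlp_gt0 x : 2 <= K -> 1 <= ln x -> 0 < dnlp x.
Proof.
move=> K2 x1; apply: lt_le_trans (dnlp_ge K2 x1).
by apply: powR_gt0; lra.
Qed.

Lemma ddnlp_ge0 x : 2 <= K -> 1 <= ln x -> 0 <= ddnlp x.
Proof.
move=> K2 x1; apply: le_trans (ddnlp_ge K2 x1).
by rewrite divr_ge0 ?powR_ge0 // ltW // ge1_ln_gt0.
Qed.

Lemma dnlp_mono x y : 2 <= K -> 1 <= ln x -> x <= y -> dnlp x <= dnlp y.
Proof.
move=> K2 x1 xy; rewrite -subr_ge0.
have [z /andP[xz _] ->] := mvt_cc xy (fun z h =>
  is_derive_dnlp (ge1_ln_le x1 (proj1 (andP h)))).
by rewrite mulr_ge0 ?subr_ge0 ?ddnlp_ge0 // (ge1_ln_le x1).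
Qed.

Lemma nlp_lower x y : 2 <= K -> 1 <= ln x -> x <= y ->
  dnlp x * (y - x) <= nlp y - nlp x.
Proof.
move=> K2 x1 xy.
have [z /andP[xz _] ->] := mvt_cc xy (fun z h =>
  is_derive_nlp (ge1_ln_le x1 (proj1 (andP h)))).
by rewrite ler_wpM2r ?subr_ge0 // dnlp_mono.
Qed.

Lemma nlp_upper x y : 2 <= K -> 1 <= ln x -> x <= y ->
  nlp y - nlp x <= dnlp y * (y - x).
Proof.
move=> K2 x1 xy.
have [z /andP[xz zy] ->] := mvt_cc xy (fun z h =>
  is_derive_nlp (ge1_ln_le x1 (proj1 (andP h)))).
by rewrite ler_wpM2r ?subr_ge0 // dnlp_mono // (ge1_ln_le x1).
Qed.

Lemma dnlp_lower M N x y : 2 <= K -> 1 <= ln M -> M <= x -> x <= y -> y <= N ->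
  ln M `^ (K - 1) / N * (y - x) <= dnlp y - dnlp x.
Proof.
move=> K2 M1 Mx xy yN; have x1 := ge1_ln_le M1 Mx.
have [z /andP[xz zy] ->] := mvt_cc xy (fun z h =>
  is_derive_dnlp (ge1_ln_le x1 (proj1 (andP h)))).
have z1 := ge1_ln_le x1 xz; have z0 := ge1_ln_gt0 z1.
rewrite ler_wpM2r ?subr_ge0 //; apply: le_trans (ddnlp_ge K2 z1).
apply: ler_pM; rewrite ?powR_ge0 ?invr_ge0 //.
- by rewrite ltW // (lt_le_trans z0) // (le_trans zy).
- apply: ge0_ler_powR; rewrite ?nnegrE; [lra|lra|lra|].
  by apply: ln_le => //; exact: le_trans xz.
- by rewrite lef_pV2 ?posrE // ?(le_trans zy) // (lt_le_trans z0) // (le_trans zy).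
Qed.

Lemma dnlp_upper M N x y : 2 <= K -> 1 <= ln M -> M <= x -> x <= y -> y <= N ->
  dnlp y - dnlp x <= K ^+ 2 * ln N `^ K / M * (y - x).
Proof.
move=> K2 M1 Mx xy yN; have x1 := ge1_ln_le M1 Mx; have M0 := ge1_ln_gt0 M1.
have [z /andP[xz zy] ->] := mvt_cc xy (fun z h =>
  is_derive_dnlp (ge1_ln_le x1 (proj1 (andP h)))).
have z1 := ge1_ln_le x1 xz; have z0 := ge1_ln_gt0 z1.
have zN : z <= N by apply: le_trans zy yN.
rewrite ler_wpM2r ?subr_ge0 //; apply: le_trans (ddnlp_le K2 z1) _.
apply: ler_pM; rewrite ?invr_ge0 ?(ltW z0) ?(mulr_ge0 (sqr_ge0 K)) ?powR_ge0 //.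
- rewrite ler_wpM2l ?sqr_ge0 //.
  have := ln_le z1 zN => zN'.
  by apply: ge0_ler_powR; rewrite ?nnegrE //; lra.
- by rewrite lef_pV2 ?posrE //; apply: (le_trans Mx).
Qed.

(** With [c = K ^ 2 / M], the function [c * nlp - dnlp] is nondecreasing beyond [M], because
    [f'' z <= K ^ 2 (ln z) ^ K / z <= c f' z]. *)
Lemma dnlp_nlp M x y : 2 <= K -> 1 <= ln M -> M <= x -> x <= y ->
  dnlp y - dnlp x <= K ^+ 2 / M * (nlp y - nlp x).
Proof.
move=> K2 M1 Mx xy; have x1 := ge1_ln_le M1 Mx; have M0 := ge1_ln_gt0 M1.
pose c := K ^+ 2 / M.
have [|z /andP[xz zy]] := @mvt_cc R (fun t => c * nlp t - dnlp t)
    (fun t => c * dnlp t - ddnlp t) x y xy.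
  move=> z /andP[xz _]; have z1 := ge1_ln_le x1 xz.
  have h1 := is_derive_nlp z1; have h2 := is_derive_dnlp z1.
  by apply: is_derive_eq; rewrite /GRing.scale /=; ring.
have z1 := ge1_ln_le x1 xz; have z0 := ge1_ln_gt0 z1.
have : 0 <= (c * dnlp z - ddnlp z) * (y - x).
  rewrite mulr_ge0 ?subr_ge0 //; apply: le_trans (ddnlp_le K2 z1) _.
  have zV : 0 <= K ^+ 2 / z by rewrite divr_ge0 ?sqr_ge0 // ltW.
  rewrite /c mulrAC; apply: (ler_pM zV (powR_ge0 _ _)).
    by rewrite ler_wpM2l ?sqr_ge0 // lef_pV2 ?posrE // (le_trans Mx).
  exact: dnlp_ge.
by move=> /[swap] <-; rewrite -/c; lra.
Qed.

(** The derivative [f' (t + h) - f' t] of [f (t + h) - f t] is at least [h] times the lower bound of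
    [f''] on [[M, N]]. This is the convexity that confines the points of a fixed offset [h]. *)
Lemma nlp_shift M N x y h : 2 <= K -> 1 <= ln M -> M <= x -> x <= y -> 0 <= h ->
  y + h <= N ->
  (y - x) * (h * (ln M `^ (K - 1) / N)) <= nlp (y + h) - nlp (x + h) - (nlp y - nlp x).
Proof.
move=> K2 M1 Mx xy h0 yhN; have x1 := ge1_ln_le M1 Mx.
have [|z /andP[xz zy]] := @mvt_cc R (fun t => nlp (t + h) - nlp t)
    (fun t => dnlp (t + h) - dnlp t) x y xy.
  move=> z /andP[xz _]; have z1 := ge1_ln_le x1 xz.
  have zh1 : 1 <= ln (z + h) by apply: ge1_ln_le z1 _; rewrite lerDl.
  have h1 := is_derive_nlp z1; have h2 := is_derive_nlp zh1.
  have h3 : is_derive z 1 (fun t => t + h) (1 + 0) by exact: is_deriveD.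
  have h4 := @is_derive1_comp R nlp (fun t => t + h) z _ _ h2 h3.
  rewrite /comp /= in h4.
  by apply: is_derive_eq; rewrite addr0 mulr1.
have -> : nlp (y + h) - nlp y - (nlp (x + h) - nlp x) =
  nlp (y + h) - nlp (x + h) - (nlp y - nlp x) by ring.
move=> ->; rewrite mulrC ler_wpM2r ?subr_ge0 //.
have zzh : z <= z + h by rewrite lerDl.
have zhN : z + h <= N by apply: le_trans yhN; rewrite lerD2r.
have := dnlp_lower K2 M1 (le_trans Mx xz) zzh zhN.
by rewrite [z + h]addrC addrK mulrC.
Qed.

(** Since [ddnlp / dnlp] decreases, [dnlp b * dnlp - ddnlp b * nlp] is nondecreasing up to [b]. So
    the slope of [dnlp] against [nlp] over [[a, b]] is at least its infinitesimal value at [b]. *)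
Lemma ratio_left a b : 2 <= K -> 1 <= ln a -> a <= b ->
  ddnlp b * (nlp b - nlp a) <= dnlp b * (dnlp b - dnlp a).
Proof.
move=> K2 a1 ab.
have [|z /andP[az zb]] := @mvt_cc R (fun t => dnlp b * dnlp t - ddnlp b * nlp t)
    (fun t => dnlp b * ddnlp t - ddnlp b * dnlp t) a b ab.
  move=> z /andP[az _]; have z1 := ge1_ln_le a1 az.
  have h1 := is_derive_nlp z1; have h2 := is_derive_dnlp z1.
  by apply: is_derive_eq; rewrite /GRing.scale /=; ring.
have : 0 <= (dnlp b * ddnlp z - ddnlp b * dnlp z) * (b - a).
  rewrite mulr_ge0 ?subr_ge0 // [dnlp b * _]mulrC.
  by apply: ddnlp_ratio_le => //; exact: ge1_ln_le az.
by move=> /[swap] <-; lra.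
Qed.

(** Counterpart at the left end: the same slope is at most its infinitesimal value at [a]. *)
Lemma ratio_right a b : 2 <= K -> 1 <= ln a -> a <= b ->
  dnlp a * (dnlp b - dnlp a) <= ddnlp a * (nlp b - nlp a).
Proof.
move=> K2 a1 ab.
have [|z /andP[az zb]] := @mvt_cc R (fun t => ddnlp a * nlp t - dnlp a * dnlp t)
    (fun t => ddnlp a * dnlp t - dnlp a * ddnlp t) a b ab.
  move=> z /andP[az _]; have z1 := ge1_ln_le a1 az.
  have h1 := is_derive_nlp z1; have h2 := is_derive_dnlp z1.
  by apply: is_derive_eq; rewrite /GRing.scale /=; ring.
have : 0 <= (ddnlp a * dnlp z - dnlp a * ddnlp z) * (b - a).
  rewrite mulr_ge0 ?subr_ge0 // [dnlp a * _]mulrC.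
  exact: ddnlp_ratio_le.
by move=> /[swap] <-; lra.
Qed.

Lemma nlp_mono x y : 2 <= K -> 1 <= ln x -> x <= y -> nlp x <= nlp y.
Proof.
move=> K2 x1 xy; rewrite -subr_ge0; apply: le_trans (nlp_lower K2 x1 xy).
by rewrite mulr_ge0 ?subr_ge0 // ltW // dnlp_gt0.
Qed.

(* The slope of a chord of [dnlp] as a function of [nlp] decreases when both
   end points move to the right, because [ddnlp / dnlp] is decreasing. *)
Lemma chord_slope_disjoint x x' y y' : 2 <= K -> 1 <= ln x ->
  x <= x' -> x' <= y -> y <= y' ->
  (dnlp y' - dnlp y) * (nlp x' - nlp x) <= (dnlp x' - dnlp x) * (nlp y' - nlp y).
Proof.
move=> K2 x1 xx' x'y yy'.
have x1' := ge1_ln_le x1 xx'; have y1 := ge1_ln_le x1' x'y.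
have A := ratio_left K2 x1 xx'; have B := ratio_right K2 y1 yy'.
have C := ddnlp_ratio_le K2 x1' x'y.
have fx : 0 <= nlp x' - nlp x by rewrite subr_ge0 nlp_mono.
have fy : 0 <= nlp y' - nlp y by rewrite subr_ge0 nlp_mono.
have px := dnlp_gt0 K2 x1'; have py := dnlp_gt0 K2 y1.
have fxy := mulr_ge0 fx fy.
have A' := ler_wpM2r fy A.
have A2 := ler_wpM2r (ltW py) A'.
have B' := ler_wpM2r fx B.
have B2 := ler_wpM2r (ltW px) B'.
have C' := ler_wpM2r fxy C.
have pxy := mulr_gt0 px py.
rewrite -(ler_pM2l pxy); move: A2 B2 C'; clear.
move: (nlp x) (nlp x') (nlp y) (nlp y') (dnlp x) (dnlp x') (dnlp y) (dnlp y').
by move: (ddnlp x') (ddnlp y) => *; lra.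
Qed.

(** Overlapping intervals are cut at [y] and [x'] into three consecutive pieces. The product
    belonging to the common middle piece cancels, and the other products are compared by the
    disjoint case. *)
Lemma chord_slope x x' y y' : 2 <= K -> 1 <= ln x ->
  x <= x' -> x <= y -> y <= y' -> x' <= y' ->
  (dnlp y' - dnlp y) * (nlp x' - nlp x) <= (dnlp x' - dnlp x) * (nlp y' - nlp y).
Proof.
move=> K2 x1 xx' xy yy' xy'.
have [x'y|/ltW yx'] := leP x' y; first exact: chord_slope_disjoint.
have y1 := ge1_ln_le x1 xy.
have A := chord_slope_disjoint K2 x1 xy yx' xy'.
have B := chord_slope_disjoint K2 x1 xy (lexx y) yx'.
have C := chord_slope_disjoint K2 y1 yx' (lexx x') xy'.
move: A B C; clear.
move: (nlp x) (nlp x') (nlp y) (nlp y') (dnlp x) (dnlp x') (dnlp y) (dnlp y').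
by move=> *; lra.
Qed.

End n_log_pow_calculus.

(** * Number of representations of a difference *)

Section representation_count.
Variables (R : realType) (K : R).
Local Notation a := (n_log_pow K).
Local Notation F n := (nlp K (n%:R : R)).
Local Notation phi n := (dnlp K (n%:R : R)).

Lemma n_log_pow_itv n : (a n)%:R <= F n < (a n)%:R + 1.
Proof.
have F0 : 0 <= F n by rewrite mulr_ge0 ?powR_ge0.
by have := truncn_itv F0; rewrite natr1.
Qed.

(** The integer parts satisfy [a y' - a y = a x' - a x], and each of the four values of [f] exceeds
    its integer part by less than 1. *)
Lemma n_log_pow_diff x y x' y' v : a y = (a x + v)%N -> a y' = (a x' + v)%N ->
  F x' - F x - 2 < F y' - F y < F x' - F x + 2.
Proof.
move=> e e'.
have := n_log_pow_itv x; have := n_log_pow_itv x'.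
have := n_log_pow_itv y; have := n_log_pow_itv y'.
rewrite e e' !natrD; move: (F x) (F x') (F y) (F y') ((a x)%:R) ((a x')%:R) (v%:R).
by move=> f f' g g' n n' w; lra.
Qed.

Lemma ln_nat_le (m n : nat) : 1 <= ln (m%:R : R) -> (m <= n)%N -> 1 <= ln (n%:R : R).
Proof. by move=> m1 mn; apply: (ge1_ln_le m1); rewrite ler_nat. Qed.

(** Here [f' >= 1], so [f] grows by at least 1 between distinct integers and its integer part
    increases strictly. *)
Lemma n_log_pow_lt m x y : 2 <= K -> 1 <= ln (m%:R : R) -> (m <= x < y)%N -> (a x < a y)%N.
Proof.
move=> K2 m1 /andP[mx xy].
have x1 := ln_nat_le m1 mx.
have xy' : x%:R + 1 <= y%:R :> R by rewrite natr1 ler_nat.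
have xy0 : x%:R <= y%:R :> R by lra.
have A := nlp_lower K2 x1 xy0.
have B := dnlp_ge K2 x1.
have C : 1 <= ln x%:R `^ K by apply: (le_trans x1); apply: le1r_powR; lra.
have D : 1 <= F y - F x.
  apply: le_trans A; apply: mulr_ege1; first exact: le_trans B.
  by move: xy'; clear; move: (x%:R : R) (y%:R : R) => s t; lra.
have := n_log_pow_itv x; have := n_log_pow_itv y.
rewrite -(ltr_nat R); move: D; clear.
by move: (F x) (F y) ((a x)%:R : R) ((a y)%:R : R) => f g n m; lra.
Qed.

(** [P] and [Q] are the advances of [x] and [nu x], [s] and [t] the slopes of [f] there. An advance
    [Q >= P + 1] would give [(P + 1) t <= g < P s + 3 <= P t + 3], against [3 <= t]. *)
Let shift_absurd (P Q s t f g : R) : P + 1 <= Q -> Q * t <= g -> f <= P * s + 1 ->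
  g < f + 2 -> s <= t -> 3 <= t -> 0 <= P -> False.
Proof. by nra. Qed.

Let slope_aux (q j s t s' t' : R) : q * s' <= (q + j) * s + 3 ->
  (q + j) * t <= q * t' + 3 -> (q + j) * (t - s) - q * (t' - s') <= 6.
Proof. lra. Qed.

(** Between two points of the same [T2 p j], [f] and [g] are the increments of [nlp] at [x] and at
    [nu x], [d] and [e] those of [dnlp], while [l = L] and [q = p - j]. The chord slope inequality
    [e f <= d g] with [g < f + 2] and [l d <= f] gives [l e <= l d + 2], hence [q e <= q d + 2];
    adding the 6 of [slope_aux] leaves [j d <= 8]. *)
Let chord_aux (l q j f g d e c X : R) : 0 < l -> 0 <= q -> q <= l -> 0 < f ->
  g < f + 2 -> e * f <= d * g -> l * d <= f -> 0 <= d ->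
  (q + j) * d - q * e <= 6 -> c * X <= d -> 0 <= j -> X * (j * c) <= 8.
Proof.
move=> l0 q0 ql f0 gf ef ld d0 dq cX j0.
have H : l * e <= l * d + 2.
  rewrite -(ler_pM2r f0).
  have H1 := ler_wpM2l (ltW l0) ef.
  have H2 := ler_wpM2l (mulr_ge0 (ltW l0) d0) (ltW gf).
  lra.
have H2 : q * e <= q * d + 2.
  rewrite -(ler_pM2l l0).
  have := ler_wpM2l q0 H; lra.
have := ler_wpM2l j0 cX; lra.
Qed.

(** [gap_count] applied to the indices [x >= M] that have a partner [nu x] with
    [a (nu x) = a x + v]. Starting at [M = L ^ 4] makes [f'] nearly constant over [L] steps, and
    [3 <= ln M] makes the slopes large enough to absorb the rounding errors. *)
Lemma repr_count (N L M v : nat) (c : R) : 2 <= K -> (0 < L)%N -> (0 < N)%N ->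
  (M = L ^ 4)%N -> 3 <= ln (M%:R : R) -> K ^+ 2 * ln (N%:R : R) `^ K <= L%:R ^+ 2 ->
  K ^+ 2 <= L%:R ^+ 3 ->
  c = ln (M%:R : R) `^ (K - 1) / N%:R ->
  #|[pred x : 'I_N.+1 | (M <= x)%N &&
       `[< exists n, (x < n <= N)%N /\ a n = (a x + v)%N >]]|%:R <=
  N%:R / L%:R + 1 + 2 / c * harm R N + (8 / c * harm R L ^+ 2 + L%:R ^+ 2).
Proof.
move=> K2 L0 N0 ME lnM KL KL3 cE.
have M1 : 1 <= ln (M%:R : R) by apply: le_trans lnM; rewrite ler1n.
have LR0 : 0 < L%:R :> R by rewrite ltr0n.
have M0 : 0 < M%:R :> R by rewrite ME ltr0n expn_gt0 L0.
have c0 : 0 < c.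
  by rewrite cE divr_gt0 ?ltr0n // powR_gt0 // (lt_le_trans _ M1).
pose P x := [set n | (x < n <= N)%N /\ a n = (a x + v)%N].
pose nu x := xget 0%N (P x).
pose s x := (M <= x)%N && `[< exists n, (x < n <= N)%N /\ a n = (a x + v)%N >].
have sP x : s x -> [/\ (M <= x)%N, (x < nu x <= N)%N & a (nu x) = (a x + v)%N].
  move=> /andP[Mx /asboolP[n Pn]].
  have [? ?] : P x (nu x) by apply: (xgetI _ Pn).
  by split.
have ge1 x : (M <= x)%N -> 1 <= ln (x%:R : R) by apply: ln_nat_le M1.
(* First-order expansion with error at most 1: the second-order term is at most [K ^ 2 (ln N) ^ K /
   M * p ^ 2 <= L ^ 2 * L ^ 2 / L ^ 4]. *)
have up x p : (M <= x)%N -> (x + p <= N)%N -> (p <= L)%N ->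
    F (x + p)%N - F x <= p%:R * phi x + 1.
  move=> Mx xpN pL.
  have le1 : x%:R <= (x + p)%N%:R :> R by rewrite ler_nat leq_addr.
  have le2 : (x + p)%N%:R <= N%:R :> R by rewrite ler_nat.
  have le3 : M%:R <= x%:R :> R by rewrite ler_nat.
  have A := nlp_upper K2 (ge1 _ Mx) le1.
  have B := dnlp_upper K2 M1 le3 le1 le2.
  have e : (x + p)%N%:R - x%:R = p%:R :> R by rewrite natrD addrC addKr.
  rewrite e in A B.
  have pL' : p%:R <= L%:R :> R by rewrite ler_nat.
  have p0 : 0 <= p%:R :> R by [].
  have D : K ^+ 2 * ln (N%:R : R) `^ K / M%:R * p%:R * p%:R <= 1.
    rewrite -mulrA mulrAC ler_pdivrMr // mul1r.
    apply: (@le_trans _ _ (L%:R ^+ 2 * L%:R ^+ 2)).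
      apply: (ler_pM (mulr_ge0 (sqr_ge0 K) (powR_ge0 _ K)) (mulr_ge0 p0 p0) KL).
      by rewrite [leRHS]expr2; apply: ler_pM.
    by rewrite -exprD ME natrX.
  apply: le_trans A _.
  have := ler_wpM2r p0 B; move: D; clear.
  move: (K ^+ 2 * _ / _) (phi (x + p)%N) (phi x) (p%:R : R) => *; lra.
have low x y : (M <= x)%N -> (x <= y)%N -> (y - x)%:R * phi x <= F y - F x.
  move=> Mx xy; rewrite natrB // mulrC.
  by apply: nlp_lower => //; [exact: ge1|rewrite ler_nat].
have mono x y : (M <= x)%N -> (x <= y)%N -> phi x <= phi y.
  by move=> Mx xy; apply: dnlp_mono => //; [exact: ge1|rewrite ler_nat].
have phi3 x : (M <= x)%N -> 3 <= phi x.
  move=> Mx; apply: le_trans (dnlp_ge K2 (ge1 _ Mx)).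
  have lx : 3 <= ln (x%:R : R).
    by apply: le_trans lnM _; apply: ln_le => //; rewrite ler_nat.
  by apply: (le_trans lx); apply: le1r_powR; [apply: ge1|apply: le_trans K2; rewrite ler1n].
have nu_lt x y : s x -> s y -> (x < y)%N -> (nu x < nu y)%N.
  move=> /sP[Mx /andP[xnx nxN] ex] /sP[My /andP[yny nyN] ey] xy.
  rewrite ltnNge; apply/negP; rewrite leq_eqVlt => nyx.
  have axy : (a x < a y)%N by apply: (n_log_pow_lt K2 M1); rewrite Mx.
  have : (a (nu y) <= a (nu x))%N.
    case/orP: nyx => [/eqP->//|nyx]; apply: ltnW.
    by apply: (n_log_pow_lt K2 M1); rewrite nyx andbT; exact: leq_trans My (ltnW yny).
  by rewrite ex ey leq_add2r leqNgt axy.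
apply: (@gap_count R N L s nu c L0 c0).
- by move=> x /sP[].
- move=> x p sx sp /andP[p0 pL].
  have xp : (x < x + p)%N by rewrite -[X in (X < _)%N]addn0 ltn_add2l.
  rewrite (ltnW (nu_lt _ _ sx sp xp)) /=.
  have [Mx /andP[xnx nxN] ex] := sP _ sx; have [Mp /andP[pnp npN] ep] := sP _ sp.
  rewrite leqNgt; apply/negP => gt.
  have Mnx : (M <= nu x)%N by apply: leq_trans Mx (ltnW xnx).
  have A := low _ _ Mnx (ltnW (leq_ltn_trans (leq_addr p (nu x)) gt)).
  have B := up _ _ Mx (ltnW (leq_trans pnp npN)) pL.
  have /andP[_ C] := n_log_pow_diff ex ep.
  have D := mono _ _ Mx (ltnW xnx).
  have E := phi3 _ Mnx.
  have G : p%:R + 1 <= (nu (x + p) - nu x)%N%:R :> R.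
    by rewrite natr1 ler_nat ltn_subRL.
  exact: (shift_absurd G A B C D E (ler0n _ p)).
(* Equal offsets: the growth forced by convexity must stay below the rounding error 2. *)
- move=> x y h sx sy xy ex ey.
  have [Mx /andP[xnx nxN] eax] := sP _ sx; have [My /andP[yny nyN] eay] := sP _ sy.
  have /andP[_ C] := n_log_pow_diff eax eay.
  have A : M%:R <= x%:R :> R by rewrite ler_nat.
  have B : x%:R <= y%:R :> R by rewrite ler_nat ltnW.
  have D : y%:R + h%:R <= N%:R :> R by rewrite -natrD -ey ler_nat.
  have := nlp_shift K2 M1 A B (ler0n _ h) D.
  rewrite -cE -!natrD -ex -ey natrB ?(ltnW xy) // => /le_trans; apply.
  by rewrite lerBlDl ltW.
move=> x y p j sx sy xy sxp syp /andP[j0 jp] pL ex ey.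
have [Mx /andP[xnx nxN] eax] := sP _ sx; have [My /andP[yny nyN] eay] := sP _ sy.
have [Mxp /andP[xpn xpN] eaxp] := sP _ sxp; have [Myp /andP[ypn ypN] eayp] := sP _ syp.
pose q := (p - j)%N.
have exq : nu (x + p) = (nu x + q)%N by rewrite addnBA // -ex addnK.
have eyq : nu (y + p) = (nu y + q)%N by rewrite addnBA // -ey addnK.
have qL : (q <= L)%N := leq_trans (leq_subr _ _) pL.
have Mnx : (M <= nu x)%N := leq_trans Mx (ltnW xnx).
have Mny : (M <= nu y)%N := leq_trans My (ltnW yny).
(* The quantity [q f' (nu x) - p f' x] is at most 3 at [x], and by [B] it is at least -3 at [y].
   Each 3 is 1 from [up] plus 2 from the integer parts. *)
have A : q%:R * phi (nu x) <= p%:R * phi x + 3.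
  have := low _ _ Mnx (leq_addr q (nu x)); rewrite addKn -exq.
  have /andP[_] := n_log_pow_diff eax eaxp.
  have := up x p Mx (ltnW (leq_trans xpn xpN)) pL.
  move: (q%:R * _) (p%:R * _) (F (x + p)%N - F x) (F (nu (x + p)) - F (nu x)); clear.
  move=> *; lra.
have B : p%:R * phi y <= q%:R * phi (nu y) + 3.
  have := low _ _ My (leq_addr p y); rewrite addKn.
  have /andP[+ _] := n_log_pow_diff eay eayp.
  have nyqN : (nu y + q <= N)%N by rewrite -eyq.
  have := up _ _ Mny nyqN qL; rewrite -eyq.
  move: (q%:R * _) (p%:R * _) (F (y + p)%N - F y) (F (nu (y + p)) - F (nu y)); clear.
  move=> *; lra.
have /andP[_ C] := n_log_pow_diff eax eay.
have nxy := nu_lt _ _ sx sy xy.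
have xy' : x%:R <= y%:R :> R by rewrite ler_nat ltnW.
have nxy' : (nu x)%:R <= (nu y)%:R :> R by rewrite ler_nat ltnW.
have xnx' : x%:R <= (nu x)%:R :> R by rewrite ler_nat ltnW.
have yny' : y%:R <= (nu y)%:R :> R by rewrite ler_nat ltnW.
have Mx' : M%:R <= x%:R :> R by rewrite ler_nat.
have yN' : y%:R <= N%:R :> R by rewrite ler_nat ltnW // (leq_trans yny).
have D := chord_slope K2 (ge1 _ Mx) xy' xnx' nxy' yny'.
have E := dnlp_nlp K2 M1 Mx' xy'.
have G := dnlp_lower K2 M1 Mx' xy' yN'.
have Fpos : 0 < F y - F x.
  apply: lt_le_trans (low _ _ Mx (ltnW xy)); rewrite mulr_gt0 ?ltr0n ?subn_gt0 //.
  by apply: lt_le_trans (phi3 _ Mx).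
have KM : K ^+ 2 / M%:R <= L%:R^-1.
  rewrite ler_pdivrMr // ler_pdivlMl // ME natrX.
  by rewrite [leRHS]exprS ler_wpM2l // ltW.
have d0 : 0 <= phi y - phi x by rewrite subr_ge0 mono // ltnW.
have E' : L%:R * (phi y - phi x) <= F y - F x.
  rewrite -ler_pdivlMl //; apply: le_trans E _.
  by rewrite ler_wpM2r // ltW.
have q0 : 0 <= q%:R :> R by [].
have qL' : q%:R <= L%:R :> R by rewrite ler_nat.
have pq : p%:R = q%:R + j%:R :> R by rewrite -natrD /q subnK.
rewrite -cE in G; rewrite natrB ?(ltnW xy) //.
apply: (chord_aux LR0 q0 qL' Fpos C D E' d0 _ G (ler0n _ j)).
by move: A B; rewrite pq; exact: slope_aux.
Qed.

End representation_count.

Lemma card_ord_lt (n M : nat) (P : pred nat) : (0 < M)%N ->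
  (forall x, P x -> (x < M)%N) -> (#|[pred x : 'I_n | P x]| <= M)%N.
Proof.
move=> M0 PM; rewrite -[X in (_ <= X)%N](prednK M0) -[in leqRHS](divn1 M.-1).
by apply: card_separated => // x y Px Py xy; have := PM _ Py; lia.
Qed.

Definition repr_pairs (a : nat -> nat) (N v : nat) : nat :=
  #|[pred q : 'I_N.+1 * 'I_N.+1 | [&& (0 < q.2)%N, (q.2 < q.1)%N & a q.1 == (a q.2 + v)%N]]|.

(** Pairs with both indices up to [n1] are counted trivially. When the larger index exceeds [n1],
    strict monotonicity makes it a function of the smaller one, so it suffices to count smaller
    indices, split at [M]. *)
Lemma repr_pairs_le (a : nat -> nat) (N v M n1 : nat) : (0 < M)%N ->
  (forall x y, (n1 <= x < y)%N -> (a x < a y)%N) ->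
  (repr_pairs a N v <= n1.+1 * n1.+1 + (M + #|[pred x : 'I_N.+1 | (M <= x)%N &&
       `[< exists n, (x < n <= N)%N /\ a n = (a x + v)%N >]]|))%N.
Proof.
move=> M0 amono; rewrite /repr_pairs.
pose X := [pred q : 'I_N.+1 * 'I_N.+1 |
  [&& (0 < q.2)%N, (q.2 < q.1)%N & a q.1 == (a q.2 + v)%N]].
pose X1 := [pred q | X q && (q.1 <= n1)%N].
pose X2 := [pred q | X q && (n1 < q.1)%N].
have -> : #|X| = (#|X1| + #|X2|)%N.
  rewrite -(cardID [pred q : 'I_N.+1 * 'I_N.+1 | (q.1 <= n1)%N] X).
  congr (_ + _)%N; apply: eq_card => q; rewrite !inE //.
  by rewrite [in RHS]andbC [in RHS]ltnNge.
apply: leq_add.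
  pose g (q : 'I_N.+1 * 'I_N.+1) : 'I_n1.+1 * 'I_n1.+1 := (inord q.1, inord q.2).
  rewrite -[X in (_ <= X * _)%N]card_ord -[X in (_ <= _ * X)%N]card_ord -card_prod.
  rewrite -(card_in_image (f := g)) ?max_card //.
  move=> [x y] [x' y']; rewrite !inE /= => /andP[/and3P[_ yx _] xn] /andP[/and3P[_ yx' _] xn'].
  move=> [/(congr1 (@nat_of_ord _)) e /(congr1 (@nat_of_ord _)) e'].
  move: e e'; rewrite !inordK ?ltnS // ?(leq_trans (ltnW yx)) ?(leq_trans (ltnW yx')) //.
  by move=> /val_inj -> /val_inj ->.
pose Y := [pred x : 'I_N.+1 | `[< exists n, (x < n <= N)%N /\ a n = (a x + v)%N >]].
apply: (@leq_trans #|Y|).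
  rewrite -(card_in_image (f := fun q : 'I_N.+1 * 'I_N.+1 => q.2) (A := X2)); last first.
    move=> [x y] [x' y']; rewrite !inE /= => /andP[/and3P[_ yx /eqP e] xn].
    move=> /andP[/and3P[_ yx' /eqP e'] xn'] yy'.
    rewrite yy' -e' in e.
    have [xx'|xx'|/val_inj xx'] := ltngtP x x'; last by rewrite yy' xx'.
      by have := amono x x'; rewrite ltnW //= xx' e ltnn => /(_ isT).
    by have := amono x' x; rewrite ltnW //= xx' e ltnn => /(_ isT).
  apply/subset_leq_card/fintype.subsetP => y /fintype.imageP[[x z]].
  rewrite inE /= => /andP[/and3P[_ zx /eqP e] _] ->.
  by rewrite inE; exists x; rewrite zx -ltnS ltn_ord.
rewrite -(cardID [pred x : 'I_N.+1 | (x < M)%N] Y) leq_add //.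
  apply: leq_trans (@card_ord_lt N.+1 M (fun x => x < M)%N M0 _); last by [].
  by apply/subset_leq_card/fintype.subsetP => x; rewrite !inE => /andP[].
by apply/subset_leq_card/fintype.subsetP => x; rewrite !inE -leqNgt.
Qed.

(** * Choice of the parameters for large [N] *)

Section asymptotics.
Variables (R : realType).
Local Notation a K := (@n_log_pow R K).

(** The inequality [ln y <= y] at [y = x ^ (1 / (2 K))], raised to the power [K]. *)
Lemma powR_ln_le_sqrt (K x : R) : 0 < K -> 1 <= x ->
  ln x `^ K <= (2 * K) `^ K * x `^ 2^-1.
Proof.
move=> K0 x1.
have x0 : 0 < x by lra.
have A : ln x <= 2 * K * x `^ (2 * K)^-1.
  have := ln_sublinear (powR_gt0 (2 * K)^-1 x0); rewrite ln_powR => /ltW.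
  by rewrite ler_pdivrMl // mulr_gt0.
have lx := ln_ge0 x1.
have B := ge0_ler_powR (ltW K0) (lx : ln x \is Num.nneg).
apply: le_trans (B _ _ A) _.
  by rewrite nnegrE mulr_ge0 ?powR_ge0 //; lra.
rewrite powRM ?powR_ge0 //; last lra.
rewrite -powRrM; have -> // : (2 * K)^-1 * K = 2^-1.
by field; rewrite gt_eqF.
Qed.

(* The gap threshold [L] of [gap_count] is taken of order [N^(1/8)]: any small
   power of [N] beats the powers of [ln N] and keeps [L ^ 4] negligible. *)
Lemma nat_root8 N : exists L, (L ^ 8 <= N < L.+1 ^ 8)%N.
Proof.
have ex0 : exists L, (L ^ 8 <= N)%N by exists 0%N.
have bd L : (L ^ 8 <= N)%N -> (L <= N)%N.
  apply: leq_trans; case: L => // L.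
  by have := @leq_pexp2l L.+1 1 8 isT isT; rewrite expn1.
case: (ex_maxnP ex0 bd) => L LN maxL; exists L; rewrite LN /= ltnNge.
by apply/negP => /maxL; rewrite ltnn.
Qed.

Lemma root8_large (K : R) (n1 : nat) : 2 <= K -> exists N0, forall N, (N0 <= N)%N ->
  exists L, [/\ (L ^ 8 <= N < L.+1 ^ 8)%N, (n1 <= L)%N, (1 < L)%N,
    12 <= ln (N%:R : R) & K ^+ 2 * ln (N%:R : R) `^ K <= L%:R].
Proof.
move=> K2.
pose D : R := K ^+ 2 * 8 `^ K * (2 * K) `^ K.
have D0 : 0 <= D := mulr_ge0 (mulr_ge0 (sqr_ge0 K) (powR_ge0 _ _)) (powR_ge0 _ _).
(* [K ^ 2 (ln N) ^ K] will be at most [D sqrt (L + 1)]; from [2 D ^ 2 < L] and [2 <= L] follows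
   [D ^ 2 (L + 1) <= L ^ 2]. *)
pose L0 := (maxn n1 (maxn 2 (Num.truncn (2 * D ^+ 2)).+1)).
pose N1 := (Num.truncn (expR 12 : R)).+1.
exists (maxn (L0 ^ 8) N1) => N; rewrite geq_max => /andP[LN N1N].
have [L LP] := nat_root8 N; have /andP[LN1 LN2] := LP.
have L0L : (L0 <= L)%N by rewrite -ltnS -(@ltn_exp2r _ _ 8) // (leq_ltn_trans LN).
have [n1L L2 DL] : [/\ (n1 <= L)%N, (1 < L)%N & (Num.truncn (2 * D ^+ 2) < L)%N].
  by move: L0L; rewrite /L0 !geq_max => /andP[? /andP[]].
have lnN : 12 <= ln (N%:R : R).
  rewrite -[leLHS]expRK ler_ln ?posrE ?expR_gt0 //.
    by apply: ltW; apply: lt_le_trans (truncnS_gt _) _; rewrite ler_nat.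
  by rewrite ltr0n (leq_trans _ N1N).
exists L; split => //.
have N0 : 0 < N%:R :> R by rewrite ltr0n (leq_trans _ N1N).
have LR : 2 <= L%:R :> R by rewrite ler_nat.
have L1 : 1 <= L.+1%:R :> R by rewrite ler1n.
have lnL : ln (N%:R : R) <= 8 * ln (L.+1%:R : R).
  rewrite mulr_natl -lnXn ?ltr0n // ler_ln ?posrE ?exprn_gt0 ?ltr0n //; last by rewrite -(ltr0n R).
  by rewrite -natrX ler_nat ltnW.
have l0 := ln_ge0 L1.
have A : ln (N%:R : R) `^ K <= 8 `^ K * ((2 * K) `^ K * L.+1%:R `^ 2^-1).
  apply: (@le_trans _ _ ((8 * ln (L.+1%:R : R)) `^ K)).
    by apply: ge0_ler_powR; rewrite ?nnegrE //; lra.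
  rewrite powRM // ler_wpM2l ?powR_ge0 // powR_ln_le_sqrt //; lra.
have B : K ^+ 2 * ln (N%:R : R) `^ K <= D * L.+1%:R `^ 2^-1.
  apply: le_trans (ler_wpM2l (sqr_ge0 K) A) _.
  by rewrite /D !mulrA.
apply: le_trans B _.
rewrite powR12_sqrt // -[leRHS]ger0_norm // -[leRHS]sqrtr_sqr.
rewrite -(ger0_norm D0) -(sqrtr_sqr D) -sqrtrM ?sqr_ge0 //.
apply: ler_wsqrtr.
have D2 : 2 * D ^+ 2 < L%:R.
  apply: lt_le_trans (truncnS_gt _) _; by rewrite ler_nat.
rewrite -natr1; move: (sqr_ge0 D) LR D2; move: (D ^+ 2) (L%:R : R) => d l d0 l2 dl.
nra.
Qed.

End asymptotics.

(** * Explicit bound for the number of representations *)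

Section repr_bound.
Variable R : realType.
Local Notation a K := (@n_log_pow R K).

(** The five terms [x1] to [x5] give [5 U]. With [y <= 2 l ^ 2] and [z ^ 2 <= 4 l ^ 2], the terms in
    [1 / c] give [4 D U] and [32 D U]. *)
Let sum_small (T x1 x2 x3 x4 x5 y z c l N w D U : R) : 0 < c -> 0 < N -> 0 < w -> 1 <= l ->
  U = N / w ->
  x1 <= U -> x2 <= U -> x3 <= U -> x4 <= U -> x5 <= U ->
  0 <= y -> y <= 2 * l -> 0 <= z -> z <= 2 * l -> c^-1 <= D * N / (w * l ^+ 2) ->
  T <= x1 + x2 + (x3 + x4 + 2 / c * y + (8 / c * z ^+ 2 + x5)) ->
  T <= (5 + 36 * D) * U.
Proof.
move=> c0 N0 w0 l1 UE h1 h2 h3 h4 h5 y0 yl z0 zl cD /le_trans; apply.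
have ci : 0 < c^-1 by rewrite invr_gt0.
have l0 : 0 < l by lra.
have A : y <= 2 * l ^+ 2.
  by apply: le_trans yl _; rewrite ler_pM2l // ler_eXnr // ltW.
have B : z ^+ 2 <= 4 * l ^+ 2.
  have := ler_pM z0 z0 zl zl; rewrite -!expr2 exprMn; lra.
have C : c^-1 * l ^+ 2 <= D * U.
  have -> : D * U = D * N / (w * l ^+ 2) * l ^+ 2.
    by rewrite UE; field; rewrite !gt_eqF.
  by rewrite ler_pM2r // exprn_gt0.
have A' := ler_wpM2l (ltW ci) A.
have B' := ler_wpM2l (ltW ci) B.
have e2 : c^-1 * (2 * l ^+ 2) = 2 * (c^-1 * l ^+ 2) by ring.
have e4 : c^-1 * (4 * l ^+ 2) = 4 * (c^-1 * l ^+ 2) by ring.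
rewrite {}e2 in A'; rewrite {}e4 in B'.
move: h1 h2 h3 h4 h5 A' B' C; clear.
have -> : 2 / c * y = 2 * (c^-1 * y) by rewrite mulrA.
have -> : 8 / c * z ^+ 2 = 8 * (c^-1 * z ^+ 2) by rewrite mulrA.
have -> : (5 + 36 * D) * U = 5 * U + 36 * (D * U) by ring.
by move: (c^-1 * y) (c^-1 * z ^+ 2) (c^-1 * l ^+ 2) (D * U) => *; lra.
Qed.

(** The bound is [B = C1 * U] with [U = N / (ln N) ^ (K - 3)]. The estimate of [B * ln N] will
    control the pairs of difference 0, the one with [B ^ 2] the variance. *)
Lemma repr_bound (K : R) : 11 <= K -> exists C : R, exists N0 : nat, 0 <= C /\
  forall N, (N0 <= N)%N -> exists B : R, [/\ 0 <= B,
    forall v, (repr_pairs (a K) N v)%:R <= B,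
    B * ln N%:R <= C * N%:R &
    B ^+ 2 * ((a K N)%:R * harm R (a K N)) * ln N%:R ^+ 4 <= C * N%:R ^+ 3].
Proof.
move=> K11; have K2 : 2 <= K by lra.
pose n1 := (Num.truncn (expR 1 : R)).+1.
have ln1 : 1 <= ln (n1%:R : R).
  rewrite -[leLHS]expRK ler_ln ?posrE ?expR_gt0 ?ltr0n //.
  by apply: ltW; exact: truncnS_gt.
have amono x y : (n1 <= x < y)%N -> (a K x < a K y)%N by apply: n_log_pow_lt.
have [N0 HN0] := root8_large (n1.+1 * n1.+1) K2.
(* Loss from replacing [ln M] by [ln N] in [c], since [ln M >= ln N / 4]. *)
pose D : R := 4 `^ (K - 1).
have D0 : 0 <= D by apply: powR_ge0.
pose C1 : R := 5 + 36 * D.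
have C10 : 0 <= C1 by rewrite /C1; lra.
exists (3 * C1 ^+ 2 + C1), N0; split.
  by rewrite addr_ge0 // mulr_ge0 // sqr_ge0.
move=> N /HN0[L [/andP[LN NL] n1L L2 l12 KL]].
set l := ln N%:R in l12 KL *.
have l1 : 1 <= l by move: l12; clear; lra.
have l0 : 0 < l by move: l12; clear; lra.
pose w := l `^ (K - 3).
have w0 : 0 < w by apply: powR_gt0.
have wl2 : l `^ (K - 1) = w * l ^+ 2.
  rewrite -(powR_mulrn 2 (ltW l0)) -powRD; last by rewrite (gt_eqF l0) implybT.
  by congr (_ `^ _); ring.
have wl3 : l `^ K = w * l ^+ 3.
  rewrite -(powR_mulrn 3 (ltW l0)) -powRD; last by rewrite (gt_eqF l0) implybT.
  by congr (_ `^ _); ring.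
(* This is [8 <= K - 3]. In the variance bound, [B ^ 2] brings [w ^ -2], [a_N] brings [w l ^ 3], the
   harmonic sum [l], and with the factor [l ^ 4] there remains [l ^ 8 / w]. *)
have l8w : l ^+ 8 <= w.
  rewrite -(powR_mulrn 8 (ltW l0)); apply: ler_powR => //.
  by move: K11; clear; lra.
have L0 : (0 < L)%N by apply: ltnW.
have LR0 : 0 < L%:R :> R by rewrite ltr0n.
have LR1 : 1 <= L%:R :> R by rewrite ler1n.
have L8N : L%:R ^+ 8 <= N%:R :> R by rewrite -natrX ler_nat.
have NR0 : 0 < N%:R :> R by apply: lt_le_trans L8N; rewrite exprn_gt0.
have N0' : (0 < N)%N by rewrite -(ltr0n R).
have KK1 : 1 <= K ^+ 2.
  by rewrite -[X in X <= _](expr1n _ 2); apply: lerXn2r; rewrite ?nnegrE //; move: K11; clear; lra.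
have qL : l `^ K <= L%:R.
  by apply: le_trans KL; rewrite ler_peMl // powR_ge0.
have wL : w <= L%:R.
  by apply: le_trans qL; rewrite wl3 ler_peMr ?(ltW w0) // exprn_ege1.
pose U := N%:R / w.
have NLU : N%:R / L%:R <= U by rewrite ler_wpM2l ?(ltW NR0) // lef_pV2.
(* As [w <= L] and [L ^ 8 <= N], [U >= N / L >= L ^ 7]; all polynomial terms in [L] are absorbed by
   [U]. *)
have LU (i : nat) : (i <= 7)%N -> L%:R ^+ i <= U.
  move=> i7; apply: le_trans NLU.
  rewrite ler_pdivlMr // -exprSr; apply: le_trans L8N.
  by rewrite ler_weXn2l.
pose M := (L ^ 4)%N.
have lnM : ln (M%:R : R) = 4 * ln (L%:R : R) by rewrite natrX lnXn // mulr_natl.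
have lM : l / 4 <= ln (M%:R : R).
  (* [N < (L + 1) ^ 8 <= (L ^ 2) ^ 8] because [2 <= L]. *)
  have : l <= 16 * ln (L%:R : R).
    rewrite mulr_natl -lnXn // ler_ln ?posrE ?exprn_gt0 //.
    rewrite -natrX ler_nat; apply: ltnW; apply: leq_trans NL _.
    by rewrite (expnM L 2 8) leq_exp2r // expnS expn1; move: L2; clear; nia.
  rewrite lnM; move: (ln (L%:R : R)) => x; clear; lra.
have lM3 : 3 <= ln (M%:R : R) by apply: le_trans lM; move: l12; clear; lra.
have L1L2 : L%:R <= L%:R ^+ 2 :> R by rewrite ler_eXnr.
have KL2 : K ^+ 2 * l `^ K <= L%:R ^+ 2 by apply: le_trans KL _.
have KL3 : K ^+ 2 <= L%:R ^+ 3.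
  apply: (@le_trans _ _ L%:R); last by rewrite ler_eXnr.
  apply: le_trans KL; rewrite ler_peMr ?sqr_ge0 //.
  by apply: (le_trans l1); apply: le1r_powR => //; move: K11; clear; lra.
pose c : R := ln (M%:R : R) `^ (K - 1) / N%:R.
have c0 : 0 < c by rewrite divr_gt0 // powR_gt0 // (lt_le_trans _ lM3).
have cD : c^-1 <= D * N%:R / (w * l ^+ 2).
  have A : w * l ^+ 2 <= ln (M%:R : R) `^ (K - 1) * D.
    rewrite -wl2 /D -powRM //; last by rewrite (le_trans _ lM3).
    apply: ge0_ler_powR; rewrite ?nnegrE ?(ltW l0) //.
    - by move: K11; clear; lra.
    - by rewrite mulr_ge0 // (le_trans _ lM3).
    - by rewrite -ler_pdivrMr.
  rewrite /c invf_div ler_pdivlMr ?mulr_gt0 ?exprn_gt0 // mulrAC.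
  rewrite ler_pdivrMr ?powR_gt0 ?(lt_le_trans _ lM3) //.
  rewrite [leRHS]mulrAC mulrC [D * _]mulrC.
  by rewrite ler_wpM2r // ltW.
have H0 n : (n <= N)%N -> harm R n <= 2 * l.
  move=> nN; apply: le_trans (harm_le R nN) _.
  by apply: le_trans (harm_ln R N0') _; rewrite -/l; move: l1; clear; lra.
have LN' : (L <= N)%N.
  by apply: leq_trans LN; have := @leq_pexp2l L 1 8 L0 isT; rewrite expn1.
pose B := C1 * U.
have U0 : 0 < U by rewrite divr_gt0.
exists B; split.
- by rewrite mulr_ge0 // ltW.
- move=> v.
  have M0 : (0 < M)%N by rewrite expn_gt0 L0.
  have := repr_pairs_le N v M0 amono.
  rewrite -(ler_nat R) !natrD.
  set S := (X in _ + (_ + X)) => T.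
  have := @repr_count R K N L M v c K2 L0 N0' erefl lM3 KL2 KL3 erefl; rewrite -/S => SB.
  have T' := le_trans T (lerD (lexx _) (lerD (lexx _) SB)).
  apply: (sum_small (x1 := (n1.+1 * n1.+1)%:R) (x2 := M%:R) (x3 := N%:R / L%:R) (x4 := 1)
     (x5 := L%:R ^+ 2) c0 NR0 w0 l1 (erefl : U = _)
     _ _ NLU _ (LU _ _) _ (H0 _ (leqnn _)) _ (H0 _ LN') cD) => //.
  + by apply: le_trans (LU 1%N _) => //; rewrite expr1 ler_nat.
  + by rewrite natrX LU.
  + by have := LU 0%N isT; rewrite expr0.
  + exact: harm_ge0.
  + exact: harm_ge0.
  + by move: T'; rewrite !addrA.
- have lw : l <= w by apply: le_trans l8w; rewrite ler_eXnr.
  have -> : B * l = C1 * N%:R * (l / w) by rewrite /B /U; field; rewrite gt_eqF.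
  apply: (@le_trans _ _ (C1 * N%:R * 1)).
    by rewrite ler_wpM2l ?ler_pdivrMr ?mul1r // mulr_ge0 // ltW.
  rewrite mulr1 ler_wpM2r ?(ltW NR0) // lerDr mulr_ge0 //; exact: sqr_ge0.
- have VN : (a K N)%:R <= N%:R * (w * l ^+ 3).
    have /andP[AF _] := n_log_pow_itv K N; apply: (le_trans AF).
    by rewrite /nlp -/l wl3.
  have HV : harm R (a K N) <= 3 * l.
    have [->|V0] := posnP (a K N).
      by rewrite /harm big_nil mulr_ge0 // ltW.
    apply: le_trans (harm_ln R V0) _.
    (* [a_N <= N (ln N) ^ K <= N L <= N ^ 2]. *)
    have : ln ((a K N)%:R : R) <= 2 * l.
      rewrite mulr_natl -lnXn // ler_ln ?posrE ?exprn_gt0 ?ltr0n //.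
      apply: le_trans VN _; rewrite -wl3 expr2 ler_wpM2l // ?(ltW NR0) //.
      by apply: (le_trans qL); rewrite ler_nat.
    move: l1; clear; move: (ln (a K N)%:R) => x; lra.
  have A : (a K N)%:R * harm R (a K N) <= N%:R * (w * l ^+ 3) * (3 * l).
    by apply: ler_pM => //; exact: harm_ge0.
  apply: (@le_trans _ _ (B ^+ 2 * (N%:R * (w * l ^+ 3) * (3 * l)) * l ^+ 4)).
    by rewrite ler_wpM2r ?exprn_ge0 ?(ltW l0) // ler_wpM2l // sqr_ge0.
  have -> : B ^+ 2 * (N%:R * (w * l ^+ 3) * (3 * l)) * l ^+ 4 =
      3 * C1 ^+ 2 * N%:R ^+ 3 * (l ^+ 8 / w).
    by rewrite /B /U; field; rewrite gt_eqF.
  apply: (@le_trans _ _ (3 * C1 ^+ 2 * N%:R ^+ 3 * 1)).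
    rewrite ler_wpM2l ?ler_pdivrMr ?mul1r // mulr_ge0 ?exprn_ge0 ?(ltW NR0) //.
    by rewrite mulr_ge0 // sqr_ge0.
  rewrite mulr1 ler_wpM2r ?exprn_ge0 ?(ltW NR0) //.
  by rewrite lerDl.
Qed.

End repr_bound.

(** * Distance to the nearest integer *)

Section dist_int.
Variable R : realType.
Implicit Types (x y e : R).

(** The infimum is attained: among all integers, the best translate is by [- floor x] or
    [- floor x - 1]. *)
Lemma dist_intP x e : dist_int x <= e <-> exists k : int, `|x + k%:~R| <= e.
Proof.
pose E := [set `|x + k%:~R| | k in [set: int]].
have E0 : has_inf E.
  split; first by exists `|x + 0%:~R|; exists 0.
  by exists 0 => _ [k _ <-].
split=> [xe|[k ke]]; last first.
  by apply: le_trans ke; apply: ge_inf; [case: E0|exists k].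
pose f := Num.floor x.
have /andP[fx xf] := mem_rg1_floor x.
have near k : `|x + (- f)%:~R| <= `|x + k%:~R| \/ `|x + (- f - 1)%:~R| <= `|x + k%:~R|.
  have [kf|kf] := lerP (- f) k.
    left; have kf' : (- f)%:~R <= k%:~R :> R by rewrite ler_int.
    rewrite ger0_norm ?ger0_norm; rewrite rmorphN /= in kf' *; [lra|lra|lra].
  right; have kf' : k%:~R <= (- f - 1)%:~R :> R by rewrite ler_int lerBrDr lezD1.
  rewrite !ler0_norm; rewrite rmorphB rmorphN /= in kf' *; lra.
have [h|h] := leP `|x + (- f)%:~R| `|x + (- f - 1)%:~R|.
  exists (- f); apply: le_trans xe; apply: lb_le_inf; first by case: E0.
  move=> _ [k _ <-]; case: (near k) => // h'; exact: le_trans h'.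
exists (- f - 1); apply: le_trans xe; apply: lb_le_inf; first by case: E0.
move=> _ [k _ <-]; case: (near k) => // h'; exact: le_trans (ltW h) h'.
Qed.

Lemma dist_int_addz x (k : int) : dist_int (x + k%:~R) = dist_int x.
Proof.
have aux y (j : int) : dist_int (y + j%:~R) <= dist_int y.
  apply/dist_intP; have /dist_intP[i yi] := lexx (dist_int y).
  by exists (i - j); rewrite -addrA -intrD [j + _]addrC subrK.
apply/eqP; rewrite eq_le aux /=.
by have := aux (x + k%:~R) (- k); rewrite -addrA -intrD subrr addr0.
Qed.

Lemma dist_intN x : dist_int (- x) = dist_int x.
Proof.
have aux y : dist_int (- y) <= dist_int y.
  apply/dist_intP; have /dist_intP[i yi] := lexx (dist_int y).
  by exists (- i); rewrite rmorphN /= -opprD normrN.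
by apply/eqP; rewrite eq_le aux /=; have := aux (- x); rewrite opprK.
Qed.

(** Half a unit turns far from the integers into near; this later converts upper bounds for measures
    into lower ones. *)
Lemma dist_int_half x e : e < dist_int x -> dist_int (x + 1 / 2) <= 1 / 2 - e.
Proof.
move=> ex; pose f := Num.floor x.
have /andP[fx xf] := mem_rg1_floor x.
have far k : e < `|x + k%:~R|.
  by apply: lt_le_trans ex _; apply/dist_intP; exists k.
have h1 := far (- f); have h2 := far (- f - 1).
apply/dist_intP; exists (- f - 1).
rewrite rmorphB rmorphN /= in h1 h2 *.
rewrite ger0_norm in h1; last lra.
rewrite ler0_norm in h2; last lra.
by rewrite ler_norml; apply/andP; split; lra.
Qed.

(** Write [n = n' g] and [v = v' g] with [g = gcdn v n]. The points [v i / n = v' i / n'] run modulo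
    1 through the multiples of [1 / n'], each hit [g] times, and an arc of length [2 e] holds at
    most [2 e n' + 1] of these. *)
Lemma count_dist_int (n v : nat) (b e : R) : (0 < n)%N -> 0 <= e ->
  #|[pred i : 'I_n | dist_int (b + v%:R * (i%:R / n%:R)) <= e]|%:R
    <= 2 * e * n%:R + (gcdn v n)%:R.
Proof.
move=> n0 e0.
pose g := gcdn v n.
have g0 : (0 < g)%N by rewrite gcdn_gt0 n0 orbT.
have gR0 : 0 < g%:R :> R by rewrite ltr0n.
have nR0 : 0 < n%:R :> R by rewrite ltr0n.
pose n' := (n %/ g)%N; pose v' := (v %/ g)%N.
have nE : n = (n' * g)%N by rewrite divnK // dvdn_gcdr.
have vE : v = (v' * g)%N by rewrite divnK // dvdn_gcdl.
have n'0 : (0 < n')%N by move: n0; rewrite nE; case: (n').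
have co : coprime n' v'.
  by rewrite /coprime -(eqn_pmul2r g0) muln_gcdl -nE -vE mul1n gcdnC.
have nRE : n%:R = n'%:R * g%:R :> R by rewrite -natrM -nE.
have vRE : v%:R = v'%:R * g%:R :> R by rewrite -natrM -vE.
pose P (i : 'I_n) := dist_int (b + v%:R * (i%:R / n%:R)) <= e.
pose Q (i : 'I_n) := [set k : int | `|b + v%:R * (i%:R / n%:R) + k%:~R| <= e].
pose kk (i : 'I_n) : int := xget 0 (Q i).
have kP i : P i -> `|b + v%:R * (i%:R / n%:R) + (kk i)%:~R| <= e.
  by move=> /dist_intP[k ke]; exact: (xgetI 0 (ke : Q i k)).
pose w (i : 'I_n) : int := (v' * i)%N%:Z + n'%:Z * kk i.
pose A : R := - (n'%:R * (b + e)).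
pose T := Num.truncn (2 * e * n'%:R).
have n'R0 : 0 < n'%:R :> R by rewrite ltr0n.
have wA i : P i -> A <= (w i)%:~R <= A + 2 * e * n'%:R.
  move=> /kP; have -> : b + v%:R * (i%:R / n%:R) + (kk i)%:~R = b + (w i)%:~R / n'%:R :> R.
    have -> : (w i)%:~R = v'%:R * i%:R + n'%:R * (kk i)%:~R :> R.
      by rewrite /w rmorphD rmorphM /= -!pmulrn natrM.
    rewrite -addrA nRE vRE; congr (_ + _); field.
    by rewrite !gt_eqF.
  rewrite ler_norml => /andP[h1 h2].
  have h3 : - e - b <= (w i)%:~R / n'%:R by lra.
  have h4 : (w i)%:~R / n'%:R <= e - b by lra.
  rewrite ler_pdivlMr // in h3; rewrite ler_pdivrMr // in h4.
  by rewrite /A; apply/andP; split; lra.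
pose z0 := Num.ceil A.
pose t i := `|w i - z0|%N.
have tP i : P i -> (t i)%:Z = w i - z0 /\ (t i <= T)%N.
  move=> Pi; have /andP[h1 h2] := wA _ Pi.
  have zw : z0 <= w i by rewrite /z0 ceil_le_int.
  have te : (t i)%:Z = w i - z0 by rewrite /t gez0_abs // subr_ge0.
  split=> //; rewrite truncn_ge_nat; last by rewrite !mulr_ge0.
  rewrite pmulrn te rmorphB /=; have := ceil_ge A; rewrite -/z0; lra.
(* The first component encodes the integer [w i], which determines [i] modulo [n'] because [v'] is
   coprime to [n']; the second is the quotient of [i] by [n']. *)
pose f (i : 'I_n) : 'I_T.+1 * 'I_g := (inord (t i), Ordinal (ltn_pmod (i %/ n') g0)).
have finj : {in P &, injective f}.
  move=> i j Pi Pj [/(congr1 (@nat_of_ord _)) ].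
  rewrite !inordK ?ltnS; [|by case: (tP _ Pj)|by case: (tP _ Pi)].
  move=> tij; rewrite !modn_small; last 2 first.
  - by rewrite ltn_divLR // mulnC -nE.
  - by rewrite ltn_divLR // mulnC -nE.
  move=> dij; have wij : w i = w j.
    have [h1 _] := tP _ Pi; have [h2 _] := tP _ Pj.
    by apply: (addIr (- z0)); rewrite -h1 -h2 tij.
  have dv : (n'%:Z %| i%:Z - j%:Z)%Z.
    rewrite -(Gauss_dvdzr (n := v'%:Z)) ?coprimez_nat //.
    apply/dvdzP; exists (kk j - kk i).
    by move: wij; rewrite /w !PoszM; lia.
  have mij : (i = j %[mod n'])%N.
    by move: dv; rewrite -eqz_mod_dvd !modz_nat eqz_nat => /eqP.
  by apply/val_inj; rewrite /= (divn_eq i n') (divn_eq j n') dij mij.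
have cardP : (#|[pred i | P i]| <= T.+1 * g)%N.
  rewrite -[X in (_ <= X * _)%N]card_ord -[X in (_ <= _ * X)%N]card_ord -card_prod.
  by rewrite -(card_in_image (f := f)) ?max_card // => i j; rewrite !inE; apply: finj.
apply: (@le_trans _ _ (T.+1 * g)%N%:R); first by rewrite ler_nat.
rewrite natrM -natr1 mulrDl mul1r lerD2r nRE mulrA ler_pM2r //.
by rewrite truncn_le // !mulr_ge0.
Qed.

End dist_int.

(** * Measure on the circle *)

Section periodic_measure.
Variable R : realType.
Notation mu := (@lebesgue_measure R).
Local Notation I01 := (`[0%R, 1%R[%classic : set R).

Lemma measurable_shift (t : R) : measurable_fun [set: R] (fun x : R => x + t).
Proof. by apply: measurable_funD => //; exact: measurable_cst. Qed.

Lemma measurable_preimage_shift (t : R) (A : set R) : measurable A ->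
  measurable ((fun x : R => x + t) @^-1` A).
Proof.
by move=> mA; rewrite -[X in measurable X]setTI; exact: (measurable_shift t).
Qed.

(** The pushforward under translation agrees with Lebesgue measure on half-open intervals, so
    uniqueness applies. *)
Lemma lebesgue_measure_shift (t : R) (A : set R) : measurable A ->
  mu ((fun x : R => x + t) @^-1` A) = mu A.
Proof.
move=> mA; pose f : measurableTypeR R -> measurableTypeR R := fun x => x + t.
have mf : measurable_fun [set: measurableTypeR R] f := measurable_shift t.
pose nu : {measure set (measurableTypeR R) -> \bar R} :=
  pushforward (mu : {measure set (measurableTypeR R) -> \bar R}) f.
rewrite [RHS](@lebesgue_measure_unique R (nu mf)) // => _ [[a b] _ <-].
rewrite /nu /= /pushforward.
have -> : f @^-1` `]a, b]%classic = `]a - t, b - t]%classic.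
  by apply/seteqP; split => x /=; rewrite /f !in_itv /= ltrBlDr lerBrDr.
rewrite !lebesgue_measure_itv /= !lte_fin ltrD2r.
by case: ifP => // _; rewrite -!EFinD; congr EFin; ring.
Qed.

Definition periodic1 (A : set R) := forall x, A (x + 1) <-> A x.

(** Cut [[0, 1[] at [t]: the part in [[t, 1[] is translated by [- t], the part in [[0, t[] by
    [1 - t], and together they fill [[0, 1[] again. *)
Lemma periodic_measure_shift (t : R) (A : set R) : 0 <= t < 1 -> measurable A ->
  periodic1 A -> mu (I01 `&` ((fun x : R => x + t) @^-1` A)) = mu (I01 `&` A).
Proof.
move=> /andP[t0 t1] mA pA.
have mI (i : interval R) : measurable ([set` i] : set R) by exact: measurable_itv.
pose B := `[t, 1[%classic `&` A; pose C := `[0, t[%classic `&` A.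
have mB : measurable B by exact: measurableI.
have mC : measurable C by exact: measurableI.
have -> : I01 `&` A = B `|` C.
  rewrite /B /C -setIUl; congr (_ `&` _); apply/seteqP; split => x /=; rewrite !in_itv /=.
    by move=> /andP[x0 x1]; have [tx|xt] := leP t x; [left|right]; rewrite ?tx ?x0 ?x1 ?xt.
  by move=> [/andP[a b]|/andP[a b]]; apply/andP; split => //; [exact: le_trans a|exact: lt_trans t1].
pose B' := (fun x : R => x + t) @^-1` B.
pose C' := (fun x : R => x + (t - 1)) @^-1` C.
have mB' : measurable B' by exact: measurable_preimage_shift.
have mC' : measurable C' by exact: measurable_preimage_shift.
have -> : I01 `&` ((fun x : R => x + t) @^-1` A) = B' `|` C'.
  rewrite /B' /C' /B /C; apply/seteqP; split => x /=; rewrite !in_itv /=.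
    move=> [/andP[x0 x1] Ax].
    have [xt|xt] := ltP (x + t) 1.
      by left; split => //; apply/andP; split; lra.
    right; split.
      by apply/andP; split; lra.
    by apply/(pA _).1; rewrite -addrA subrK.
  move=> [[/andP[a b] Ax]|[/andP[a b] Ax]].
    by split => //; apply/andP; split; lra.
  split; first by apply/andP; split; lra.
  by have := (pA _).2 Ax; rewrite -addrA subrK.
rewrite !measureU //.
- by congr (_ + _)%E; exact: lebesgue_measure_shift.
- apply/seteqP; split => x // [[a _] [b _]]; move: a b; rewrite /= !in_itv /=.
  by move=> /andP[a _] /andP[_ b]; lra.
- apply/seteqP; split => x // [[a _] [b _]]; move: a b; rewrite /= !in_itv /=.
  by move=> /andP[a b] /andP[c d]; lra.
Qed.

End periodic_measure.

(** Integrate the pointwise bound on the number of sets containing [x]. *)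
Lemma sum_measure_le d (T : measurableType d) (R : realType)
    (mu : {measure set T -> \bar R}) (n : nat) (D : set T) (S : 'I_n -> set T) (b : R) :
  measurable D -> (forall i, measurable (S i)) -> 0 <= b ->
  (forall x, D x -> \sum_(i < n) \1_(S i) x <= b) ->
  (\sum_(i < n) mu (D `&` S i) <= b%:E * mu D)%E.
Proof.
move=> mD mS b0 Sb.
rewrite -(integral_cst mu mD b%:E).
have -> : (\sum_(i < n) mu (D `&` S i) = \sum_(i < n) \int[mu]_(x in D) (\1_(S i) x)%:E)%E.
  by apply: eq_bigr => i _; rewrite (setIC D) integral_indic.
rewrite -ge0_integral_sum //; last first.
  by move=> i; apply/measurable_EFinP; exact: measurable_indic.
apply: ge0_le_integral => //.
- by move=> x _; apply: sume_ge0 => i _; rewrite lee_fin.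
- by apply: emeasurable_sum => i; apply/measurable_EFinP; exact: measurable_indic.
- by move=> x Dx; rewrite sumEFin lee_fin; exact: Sb.
Qed.

Section dist_sets.
Variable R : realType.
Notation mu := (@lebesgue_measure R).
Notation I01 := (`[0%R, 1%R[%classic : set R).

(** The offset [b] makes the family stable under translation. *)
Definition near_set (e b : R) (u : nat) : set R :=
  [set x | dist_int (u%:R * x + b) <= e].

Lemma measurable_near_set e b u : measurable (near_set e b u).
Proof.
(* Countable union over the integers; an index that decodes to nothing stands for 0, which adds no
   point. *)
have -> : near_set e b u = \bigcup_(n in [set: nat])
    [set x : R | `|u%:R * x + b + (if unpickle n is Some k then k else 0 : int)%:~R| <= e].
  apply/seteqP; split => x.
    move=> /dist_intP[k ke]; exists (pickle k) => //.
    by rewrite /= pickleK.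
  by move=> [n _ /= ke]; apply/dist_intP; eexists; exact: ke.
apply: bigcupT_measurable => n; set k := (if _ is Some _ then _ else _).
have -> : [set x : R | `|u%:R * x + b + k%:~R| <= e] =
  (fun x : R => `|u%:R * x + b + k%:~R|) @^-1` `]-oo, e]%classic.
  by apply/seteqP; split => x /=; rewrite in_itv.
rewrite -[X in measurable X]setTI.
have mf : measurable_fun [set: R] (fun x : R => `|u%:R * x + b + k%:~R|).
  apply: measurableT_comp; first exact: normr_measurable.
  by do 2![apply: measurable_funD; last exact: measurable_cst]; exact: mulrl_measurable.
by apply: mf => //; exact: measurable_itv.
Qed.

Lemma periodic1_near_set e b u : periodic1 (near_set e b u).
Proof.
move=> x; rewrite /near_set /= mulrDr mulr1 addrAC.
by have := dist_int_addz (u%:R * x + b) u%:Z; rewrite -pmulrn => ->.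
Qed.

Lemma near_set_shift e b u t :
  (fun x : R => x + t) @^-1` near_set e b u = near_set e (b + u%:R * t) u.
Proof. by apply/seteqP; split => x; rewrite /near_set /= mulrDr -addrA [_ * t + b]addrC. Qed.

Lemma sum_indic_near_set n u (e b x : R) : (0 < n)%N -> 0 <= e ->
  \sum_(i < n) \1_(near_set e (b + u%:R * (i%:R / n%:R)) u) x <=
    2 * e * n%:R + (gcdn u n)%:R.
Proof.
move=> n0 e0; apply: le_trans (count_dist_int u (u%:R * x + b) n0 e0).
rewrite -sum1_card natr_sum [leRHS]big_mkcond; apply: ler_sum => i _.
rewrite /= indicE inE /near_set.
case: ifPn => [_|]; first by case: (_ \in _).
rewrite -addrA => /negP h; rewrite memNset //.
Qed.

Definition circle_measure (A : set R) : R := fine (mu (I01 `&` A)).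

Lemma mu01 : mu I01 = 1%E.
Proof. by rewrite lebesgue_measure_itv /= lte_fin ltr01 oppr0 adde0. Qed.

Lemma circle_measureE A : measurable A -> mu (I01 `&` A) = (circle_measure A)%:E.
Proof.
move=> mA; rewrite /circle_measure fineK // ge0_fin_numE ?measure_ge0 //.
apply: (@le_lt_trans _ _ (mu I01)); last by rewrite mu01 ltry.
apply: le_measure; rewrite ?inE //.
by apply: measurableI => //; exact: measurable_itv.
Qed.

Lemma circle_measure_shift t A : 0 <= t < 1 -> measurable A -> periodic1 A ->
  circle_measure ((fun x : R => x + t) @^-1` A) = circle_measure A.
Proof. by move=> t01 mA pA; rewrite /circle_measure periodic_measure_shift. Qed.

Lemma circle_measure_le A B : measurable A -> measurable B -> A `<=` B ->
  circle_measure A <= circle_measure B.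
Proof.
move=> mA mB AB; rewrite -lee_fin -!circle_measureE //.
apply: le_measure; rewrite ?inE; last exact: setIS.
- by apply: measurableI => //; exact: measurable_itv.
- by apply: measurableI => //; exact: measurable_itv.
Qed.

Lemma circle_measure_setC A : measurable A -> circle_measure (~` A) = 1 - circle_measure A.
Proof.
move=> mA.
have mC : measurable (~` A) by exact: measurableC.
have mI : measurable I01 by exact: measurable_itv.
apply: EFin_inj; rewrite EFinB -!circle_measureE // -mu01.
have -> : I01 `&` ~` A = I01 `\` (I01 `&` A).
  by rewrite setDIr setDv set0U setDE.
rewrite measureD //; last by rewrite [X in (X < _)%E]mu01 ltry.
  by rewrite setIA setIid.
exact: measurableI.
Qed.

(* Averaging over the shifts by multiples of [1 / n], which leave [A] and
   Lebesgue measure on the circle invariant. *)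
Lemma circle_measure_near_set_avg n u (e b : R) (A : set R) : (0 < n)%N -> 0 <= e ->
  measurable A -> periodic1 A ->
  (forall i : 'I_n, (fun x : R => x + i%:R / n%:R) @^-1` A = A) ->
  n%:R * circle_measure (A `&` near_set e b u) <=
    (2 * e * n%:R + (gcdn u n)%:R) * circle_measure A.
Proof.
move=> n0 e0 mA pA invA.
have mI : measurable I01 by exact: measurable_itv.
have mIA : measurable (I01 `&` A) by exact: measurableI.
pose S (i : 'I_n) := near_set e (b + u%:R * (i%:R / n%:R)) u.
have b0 : 0 <= 2 * e * n%:R + (gcdn u n)%:R by rewrite addr_ge0 // !mulr_ge0.
have h : (\sum_(i < n) mu (I01 `&` A `&` S i) <=
    (2 * e * n%:R + (gcdn u n)%:R)%:E * mu (I01 `&` A))%E.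
  apply: sum_measure_le => //; first by move=> i; exact: measurable_near_set.
  by move=> x _; exact: sum_indic_near_set.
rewrite (circle_measureE mA) in h.
rewrite -lee_fin EFinM; apply: le_trans h.
have e1 i : mu (I01 `&` A `&` S i) = (circle_measure (A `&` near_set e b u))%:E.
  have mAN : measurable (A `&` near_set e b u).
    by apply: measurableI => //; exact: measurable_near_set.
  have pAN : periodic1 (A `&` near_set e b u).
    move=> x; split => -[h1 h2]; split; first [exact/(pA _).1|exact/(pA _).2|
      exact/(periodic1_near_set _ _ _ _).1|exact/(periodic1_near_set _ _ _ _).2].
  have t01 : 0 <= (i%:R / n%:R : R) < 1.
    by rewrite divr_ge0 // ltr_pdivrMr ?ltr0n // mul1r ltr_nat ltn_ord.
  rewrite -(circle_measure_shift t01 mAN pAN) preimage_setI invA near_set_shift -/(S i).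
  by rewrite -setIA circle_measureE //; apply: measurableI => //; exact: measurable_near_set.
under eq_bigr do rewrite e1.
by rewrite sumEFin sumr_const card_ord -EFinM mulr_natl.
Qed.

Lemma circle_measure_setT : circle_measure [set: R] = 1.
Proof. by rewrite /circle_measure setIT mu01. Qed.

(** Average over [n = u q] rotations of the whole circle: as [gcdn u (u q) = u], the bound is
    [2 e + 1 / q], with [q] arbitrarily large. *)
Lemma circle_measure_near_set_le u (e b : R) : (0 < u)%N -> 0 <= e ->
  circle_measure (near_set e b u) <= 2 * e.
Proof.
move=> u0 e0; apply/ler_addgt0Pr => d d0.
pose q := (Num.truncn d^-1).+1.
have qd : q%:R^-1 <= d.
  by rewrite invf_ple ?posrE ?ltr0n // ltW // truncnS_gt.
have n0 : (0 < u * q)%N by rewrite muln_gt0 u0.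
have := @circle_measure_near_set_avg (u * q) u e b setT n0 e0 measurableT (fun _ => conj id id)
  (fun _ => preimage_setT _).
rewrite setTI circle_measure_setT mulr1 gcdnMr mulrC -ler_pdivlMr ?ltr0n // => h.
apply: le_trans h _; rewrite mulrDl mulfK ?pnatr_eq0 ?gtn_eqF // lerD2l.
apply: le_trans qd; rewrite natrM ler_pdivrMr ?mulr_gt0 ?ltr0n //.
by rewrite mulrCA mulVf ?mulr1 // pnatr_eq0.
Qed.

(** For the lower bound, the complement lies in a near set of radius [1 / 2 - e] and offset [1 / 2],
    of measure at most [1 - 2 e]. *)
Lemma circle_measure_near_set u (e : R) : (0 < u)%N -> 0 <= e <= 1 / 2 ->
  circle_measure (near_set e 0 u) = 2 * e.
Proof.
move=> u0 /andP[e0 e1]; apply/eqP; rewrite eq_le circle_measure_near_set_le //=.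
have mN := measurable_near_set e 0 u.
have : circle_measure (~` near_set e 0 u) <= 2 * (1 / 2 - e).
  apply: le_trans (@circle_measure_near_set_le u (1 / 2 - e) (1 / 2) u0 _); last lra.
  apply: circle_measure_le; [exact: measurableC|exact: measurable_near_set|].
  move=> x /= /negP; rewrite -ltNge => h; rewrite /near_set /=.
  by have := dist_int_half h; rewrite addr0.
rewrite circle_measure_setC //; lra.
Qed.

Lemma near_set_invariant u (e : R) (i : 'I_u) :
  (fun x : R => x + i%:R / u%:R) @^-1` near_set e 0 u = near_set e 0 u.
Proof.
rewrite near_set_shift; apply/seteqP; split => x; rewrite /near_set /=.
  rewrite add0r mulrCA divff ?mulr1 ?addr0.
    by have := dist_int_addz (u%:R * x) i%:Z; rewrite -pmulrn => ->.
  by rewrite pnatr_eq0 -lt0n (leq_ltn_trans (leq0n i) (ltn_ord i)).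
rewrite add0r mulrCA divff ?mulr1 ?addr0.
  by have := dist_int_addz (u%:R * x) i%:Z; rewrite -pmulrn => ->.
by rewrite pnatr_eq0 -lt0n (leq_ltn_trans (leq0n i) (ltn_ord i)).
Qed.

(** Average over the rotations by [i / u], which preserve the first set. Exchanging the roles of [u]
    and [v] then gives the denominator [maxn u v]. *)
Lemma circle_measure_near_setI_le u v (e : R) : (0 < u)%N -> 0 <= e ->
  circle_measure (near_set e 0 u `&` near_set e 0 v) <=
    4 * e ^+ 2 + 2 * e * ((gcdn u v)%:R / u%:R).
Proof.
move=> u0 e0; have uR0 : 0 < u%:R :> R by rewrite ltr0n.
have := @circle_measure_near_set_avg u v e 0 (near_set e 0 u) u0 e0 (measurable_near_set _ _ _)
   (periodic1_near_set _ _ _) (@near_set_invariant u e).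
rewrite mulrC -ler_pdivlMr // => /le_trans; apply.
rewrite ler_pdivrMr // [gcdn v u]gcdnC.
have h := circle_measure_near_set_le 0 u0 e0.
have c0 : 0 <= 2 * e * u%:R + (gcdn u v)%:R :> R by rewrite addr_ge0 // !mulr_ge0.
apply: le_trans (ler_wpM2l c0 h) _.
rewrite le_eqVlt; apply/orP; left; apply/eqP; field.
by rewrite gt_eqF.
Qed.

Lemma circle_measure_near_setI_max u v (e : R) : (0 < u)%N -> (0 < v)%N -> 0 <= e ->
  circle_measure (near_set e 0 u `&` near_set e 0 v) <=
    4 * e ^+ 2 + 2 * e * ((gcdn u v)%:R / (maxn u v)%:R).
Proof.
move=> u0 v0 e0; have [vu|/ltnW uv] := leqP v u; first exact: circle_measure_near_setI_le.
by rewrite setIC gcdnC; exact: circle_measure_near_setI_le.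
Qed.

End dist_sets.

(** * Variance of weighted sums of indicators *)

Section variance.
Context d (T : measurableType d) (R : realType) (mu : {measure set T -> \bar R}).
Variables (D : set T) (B : nat -> set T).
Hypothesis mD : measurable D.
Hypothesis mB : forall i, measurable (B i).

Lemma integral_indicZ (c : R) (A : set T) : 0 <= c -> measurable A ->
  (\int[mu]_(x in D) (c * \1_A x)%:E = c%:E * mu (A `&` D))%E.
Proof.
move=> c0 mA; under eq_integral do rewrite EFinM.
rewrite ge0_integralZl_EFin //; first by rewrite integral_indic.
by apply/measurable_EFinP; exact: measurable_indic.
Qed.

Lemma integral_step_fun (s : seq nat) (c : nat -> R) (A : nat -> set T) :
  (forall i, 0 <= c i) -> (forall i, measurable (A i)) ->
  (\int[mu]_(x in D) (\sum_(i <- s) c i * \1_(A i) x)%:E =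
    \sum_(i <- s) (c i)%:E * mu (A i `&` D))%E.
Proof.
move=> c0 mA; under eq_integral do rewrite -sumEFin.
rewrite ge0_integral_sum //.
- by apply: eq_bigr => i _; exact: integral_indicZ.
- move=> i; apply/measurable_EFinP; apply: measurable_funM; [exact: measurable_cst|exact: measurable_indic].
- by move=> i x _; rewrite lee_fin mulr_ge0.
Qed.

Variables (s : seq nat) (r : nat -> R).
Hypothesis r0 : forall v, 0 <= r v.

Definition step_fun (x : T) : R := \sum_(v <- s) r v * \1_(B v) x.

Lemma step_fun_ge0 x : 0 <= step_fun x.
Proof. by apply: sumr_ge0 => v _; rewrite mulr_ge0. Qed.

Lemma measurable_step_fun E : measurable_fun E step_fun.
Proof.
apply: measurable_sum => v; apply: measurable_funM; [exact: measurable_cst|exact: measurable_indic].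
Qed.

Lemma integral_step_fun_sqr :
  (\int[mu]_(x in D) (step_fun x ^+ 2)%:E =
   \sum_(u <- s) \sum_(v <- s) (r u * r v)%:E * mu (B u `&` B v `&` D))%E.
Proof.
have E x : step_fun x ^+ 2 =
    \sum_(u <- s) \sum_(v <- s) r u * r v * \1_(B u `&` B v) x.
  rewrite /step_fun expr2 mulr_suml; apply: eq_bigr => u _.
  rewrite mulr_sumr; apply: eq_bigr => v _.
  by rewrite indicI /= mulrACA.
under eq_integral do rewrite E -sumEFin.
have mN u v : measurable (B u `&` B v) by apply: measurableI.
rewrite ge0_integral_sum //.
- apply: eq_bigr => u _; apply: integral_step_fun => // v.
  by rewrite mulr_ge0.
- move=> u; apply/measurable_EFinP; apply: measurable_sum => v.
  apply: measurable_funM; [exact: measurable_cst|exact: measurable_indic].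
- by move=> u x _; rewrite lee_fin sumr_ge0 // => v _; rewrite !mulr_ge0.
Qed.

Lemma variance_step_fun (p : R) (t : nat -> nat -> R) : 0 <= p -> mu D = 1%E ->
  (forall v, v \in s -> mu (B v `&` D) = p%:E) ->
  (forall u v, u \in s -> v \in s -> mu (B u `&` B v `&` D) <= (p ^+ 2 + t u v)%:E)%E ->
  (\int[mu]_(x in D) ((step_fun x - p * \sum_(v <- s) r v) ^+ 2)%:E
   <= (\sum_(u <- s) \sum_(v <- s) r u * r v * t u v)%:E)%E.
Proof.
move=> p0 muD muB muBB.
set P := \sum_(v <- s) r v; set V := \sum_(u <- s) _.
pose m := p * P; rewrite -/m.
have P0 : 0 <= P by apply: sumr_ge0.
have m0 : 0 <= m by rewrite mulr_ge0.
have mY := @measurable_step_fun D.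
have EY : (\int[mu]_(x in D) (step_fun x)%:E = m%:E)%E.
  rewrite integral_step_fun // /m /P mulr_sumr -sumEFin.
  by apply: eq_big_seq => v vs; rewrite muB // mulrC.
have mIE : (\int[mu]_(x in D) (m ^+ 2)%:E = (m ^+ 2)%:E)%E.
  by rewrite (integral_cst mu mD (m ^+ 2)%:E) muD mule1.
(* The square is expanded with the negative term moved to the other side, so that only integrals of
   nonnegative functions are added and integrability need not be known beforehand. *)
have key : (\int[mu]_(x in D) ((step_fun x - m) ^+ 2)%:E + (2 * m * m)%:E =
    \int[mu]_(x in D) (step_fun x ^+ 2)%:E + (m ^+ 2)%:E)%E.
  have m2 : 0 <= 2 * m by rewrite mulr_ge0.
  have mS : measurable_fun D (fun x => (step_fun x ^+ 2)%:E).
    by apply/measurable_EFinP; exact: measurable_funX.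
  have mS2 : measurable_fun D (fun x => ((step_fun x - m) ^+ 2)%:E).
    by apply/measurable_EFinP; apply: measurable_funX; apply: measurable_funB.
  have mS3 : measurable_fun D (fun x => (2 * m * step_fun x)%:E).
    by apply/measurable_EFinP; apply: measurable_funM.
  have S0 x : D x -> (0 <= (step_fun x ^+ 2)%:E)%E by rewrite lee_fin sqr_ge0.
  have S1 x : D x -> (0 <= ((step_fun x - m) ^+ 2)%:E)%E by rewrite lee_fin sqr_ge0.
  have S2 x : D x -> (0 <= (step_fun x)%:E)%E by rewrite lee_fin step_fun_ge0.
  have S3 x : D x -> (0 <= (2 * m * step_fun x)%:E)%E.
    by rewrite lee_fin mulr_ge0 // step_fun_ge0.
  have S4 x : D x -> (0 <= (m ^+ 2)%:E)%E by rewrite lee_fin sqr_ge0.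
  rewrite -[in RHS]mIE -ge0_integralD //.
  have -> : ((2 * m * m)%:E = \int[mu]_(x in D) ((2 * m) * step_fun x)%:E)%E.
    under eq_integral do rewrite EFinM.
    rewrite ge0_integralZl_EFin //; first by rewrite EY EFinM.
    exact/measurable_EFinP.
  rewrite -ge0_integralD //.
  by apply: eq_integral => x _; rewrite -!EFinD; congr EFin; ring.
have EY2 : (\int[mu]_(x in D) (step_fun x ^+ 2)%:E <= (m ^+ 2 + V)%:E)%E.
  rewrite integral_step_fun_sqr.
  apply: (@le_trans _ _ (\sum_(u <- s) \sum_(v <- s) (r u * r v * (p ^+ 2 + t u v))%:E)%E).
    rewrite !big_seq; apply: lee_sum => u us.
    rewrite !big_seq; apply: lee_sum => v vs.
    by rewrite [leRHS]EFinM lee_wpmul2l ?lee_fin ?mulr_ge0 // muBB.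
  under eq_bigr do rewrite sumEFin.
  rewrite sumEFin lee_fin /V.
  under eq_bigr do under eq_bigr do rewrite mulrDr.
  under eq_bigr do rewrite big_split /=.
  rewrite big_split /= lerD2r.
  rewrite (_ : m ^+ 2 = P * P * p ^+ 2); last by rewrite /m; ring.
  rewrite /P big_distrlr /= mulr_suml.
  by apply: ler_sum => u _; rewrite mulr_suml.
move: key; case: (\int[mu]_(x in D) _)%E EY2 => [y2| |].
- rewrite lee_fin => h.
  case: (\int[mu]_(x in D) _)%E => [y| |] //.
  by rewrite -!EFinD => -[h2]; rewrite lee_fin; lra.
- by rewrite leye_eq.
- by move=> _; case: (\int[mu]_(x in D) _)%E => [y| |] // _; rewrite leNye.
Qed.

End variance.

(** The covariance excess is [2 e gcdn u v / maxn u v]; once the weights are bounded by [Rb],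
    [sum_gcd_max_le] sums it. *)
Lemma variance_near (R : realType) (V : nat) (r : nat -> R) (e Rb : R) : 0 <= e <= 1 / 2 ->
  (forall v, 0 <= r v <= Rb) ->
  (\int[@lebesgue_measure R]_(x in `[0%R, 1%R[%classic)
     ((step_fun (near_set e 0) (index_iota 1 V.+1) r x -
         2 * e * \sum_(1 <= v < V.+1) r v) ^+ 2)%:E
   <= (4 * e * Rb ^+ 2 * (V%:R * harm R V))%:E)%E.
Proof.
move=> e01 rb; have /andP[e0 e1] := e01.
set s := index_iota 1 V.+1.
have r0 v : 0 <= r v by case/andP: (rb v).
have sP v : v \in s -> (0 < v)%N by rewrite mem_index_iota => /andP[].
pose t u v : R := 2 * e * ((gcdn u v)%:R / (maxn u v)%:R).
have mI : measurable (`[0%R, 1%R[%classic : set R) by exact: measurable_itv.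
have mN := fun v => measurable_near_set e 0 v.
have e20 : 0 <= 2 * e by rewrite mulr_ge0.
have H := @variance_step_fun _ _ R (@lebesgue_measure R) `[0%R, 1%R[%classic
   (near_set e 0) mI mN s r r0 (2 * e) t e20 (mu01 R).
apply: le_trans (H _ _) _.
- by move=> v /sP v0; rewrite setIC -(circle_measure_near_set v0 e01); exact: (circle_measureE (mN v)).
- move=> u v /sP u0 /sP v0.
  rewrite setIC [X in (X <= _)%E](circle_measureE (measurableI _ _ (mN u) (mN v))) lee_fin.
  apply: le_trans (circle_measure_near_setI_max u0 v0 e0) _.
  by rewrite /t exprMn lerD2r -[2 ^+ 2]natrX.
rewrite lee_fin.
apply: (@le_trans _ _ (\sum_(u <- s) \sum_(v <- s)
     2 * e * Rb ^+ 2 * ((gcdn u v)%:R / (maxn u v)%:R))).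
  apply: ler_sum => u _; apply: ler_sum => v _; rewrite /t.
  have g0 : 0 <= (gcdn u v)%:R / (maxn u v)%:R :> R by rewrite divr_ge0.
  have rr : r u * r v <= Rb ^+ 2.
    by rewrite expr2; apply: ler_pM => //; [case/andP: (rb u)|case/andP: (rb v)].
  rewrite [leRHS](_ : _ = Rb ^+ 2 * (2 * e * ((gcdn u v)%:R / (maxn u v)%:R))); last by ring.
  by rewrite ler_wpM2r // mulr_ge0.
under eq_bigr do rewrite -mulr_sumr.
rewrite -mulr_sumr.
rewrite [leRHS](_ : _ = 2 * e * Rb ^+ 2 * (2 * (V%:R * harm R V))); last by ring.
by rewrite ler_wpM2l ?sum_gcd_max_le // mulr_ge0 // sqr_ge0.
Qed.

(** * Pair correlation as a sum over differences *)

(** Unnormalized count whose tolerance [e] is independent of [N], hence monotone in [e] and [N]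
    separately. *)
Definition close_pairs (R : realType) (a : nat -> nat) (e x : R) (N : nat) : nat :=
  #|[pred p : 'I_N.+1 * 'I_N.+1 |
      [&& (1 <= p.1)%N, (1 <= p.2)%N, p.1 != p.2 &
          dist_int ((a p.1)%:R * x - (a p.2)%:R * x) <= e]]|.

Lemma sum1_ord (N : nat) (F : nat -> nat) :
  (\sum_(1 <= i < N.+1) F i = \sum_(i < N.+1) (0 < i) * F i)%N.
Proof.
rewrite big_add1 /= big_mkord big_ord_recl /= mul0n add0n.
by apply: eq_bigr => i _; rewrite /bump /= mul1n.
Qed.

Section close_pairs.
Variables (R : realType) (a : nat -> nat).

Lemma close_pairs_sum (e x : R) (N : nat) :
  close_pairs a e x N =
  (\sum_(1 <= i < N.+1) \sum_(1 <= j < N.+1)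
    ((i != j) && (dist_int ((a i)%:R * x - (a j)%:R * x) <= e)%R))%N.
Proof.
rewrite sum1_ord; under eq_bigr do rewrite sum1_ord.
rewrite /close_pairs -sum1_card big_mkcond /=.
rewrite -(pair_bigA _ (fun i j : 'I_N.+1 => if [&& (1 <= i)%N, (1 <= j)%N, i != j &
          (dist_int ((a i)%:R * x - (a j)%:R * x) <= e)%R] then 1 else 0)%N) /=.
apply: eq_bigr => i _; rewrite big_distrr /=; apply: eq_bigr => j _.
by case: (0 < i)%N; case: (0 < j)%N => //=; rewrite !mul1n -val_eqE; case: (_ && _).
Qed.

Lemma close_pairs_le (e e' x : R) (N N' : nat) : (N <= N')%N -> e <= e' ->
  (close_pairs a e x N <= close_pairs a e' x N')%N.
Proof.
move=> NN ee; rewrite !close_pairs_sum.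
have mono (F G : nat -> nat) : (forall i, (F i <= G i)%N) ->
    (\sum_(1 <= i < N.+1) F i <= \sum_(1 <= i < N'.+1) G i)%N.
  move=> FG; rewrite [leqRHS](@big_cat_nat _ _ _ N.+1) //=.
  by apply: leq_trans (leq_addr _ _); apply: leq_sum.
apply: (mono _ _) => i; apply: (mono _ _) => j.
by case: (i != j) => //=; case: leP => // h; rewrite (le_trans h ee).
Qed.

Lemma repr_pairs_sum (N v : nat) :
  repr_pairs a N v =
  (\sum_(1 <= i < N.+1) \sum_(1 <= j < N.+1) ((j < i) && (a i == a j + v)))%N.
Proof.
rewrite sum1_ord; under eq_bigr do rewrite sum1_ord.
rewrite /repr_pairs -sum1_card big_mkcond /=.
rewrite -(pair_bigA _ (fun i j : 'I_N.+1 => if [&& (0 < j)%N, (j < i)%N &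
   a i == (a j + v)%N] then 1 else 0)%N) /=.
apply: eq_bigr => i _; rewrite big_distrr /=; apply: eq_bigr => j _.
case: (posnP i) => [->|i0]; first by rewrite ltn0 andbF.
by rewrite mul1n; case: (0 < j)%N => //=; rewrite mul1n; case: (_ && _).
Qed.

Lemma sum_ltn_sym (N : nat) (F : nat -> nat -> nat) :
  (forall i j, F i j = F j i) ->
  (\sum_(1 <= i < N.+1) \sum_(1 <= j < N.+1) (i != j) * F i j =
   2 * \sum_(1 <= i < N.+1) \sum_(1 <= j < N.+1) (j < i) * F i j)%N.
Proof.
move=> Fs; rewrite mul2n -addnn [X in (_ = _ + X)%N]exchange_big -big_split /=.
apply: eq_bigr => i _; rewrite -big_split /=; apply: eq_bigr => j _.
by rewrite [F j i]Fs -mulnDl neq_ltn; congr (_ * _)%N; case: ltngtP.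
Qed.

(** Ordered pairs are twice the pairs with [j < i], which are grouped by the difference [a i - a j].
    Difference 0 is always close, whatever [x]. *)
Lemma close_pairs_repr (e x : R) (N V : nat) : 0 <= e ->
  (forall i j, (0 < i <= j)%N -> (j <= N)%N -> (a i <= a j <= V)%N) ->
  (close_pairs a e x N)%:R =
    2 * ((repr_pairs a N 0)%:R + step_fun (near_set e 0) (index_iota 1 V.+1)
      (fun v => (repr_pairs a N v)%:R : R) x) :> R.
Proof.
move=> e0 amono.
pose F i j : nat := (dist_int ((a i)%:R * x - (a j)%:R * x) <= e)%R.
have Fs i j : F i j = F j i by rewrite /F -dist_intN opprB.
have near v : \1_(near_set e 0 v) x = ((dist_int (v%:R * x) <= e)%R : nat)%:R :> R.
  rewrite indicE; congr (nat_of_bool _)%:R.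
  by apply/idP/idP; rewrite inE /near_set /= addr0.
have -> : close_pairs a e x N =
    (2 * \sum_(0 <= v < V.+1) repr_pairs a N v * (dist_int (v%:R * x) <= e)%R)%N.
  rewrite close_pairs_sum.
  under eq_bigr do under eq_bigr do rewrite -mulnb.
  rewrite (sum_ltn_sym N Fs); congr (2 * _)%N.
  under [RHS]eq_bigr do rewrite repr_pairs_sum big_distrl /=.
  rewrite [RHS]exchange_big /= !big_nat; apply: eq_bigr => i /andP[i0 iN].
  under [RHS]eq_bigr do rewrite big_distrl /=.
  rewrite [RHS]exchange_big /= !big_nat; apply: eq_bigr => j /andP[j0 jN].
  have [ji|ji] := ltnP j i; last by rewrite mul0n big1 // => v _; rewrite mul0n.
  have /andP[ji' iV] : (a j <= a i <= V)%N by apply: amono; [rewrite j0 ltnW|].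
  have vin : (a i - a j)%N \in index_iota 0 V.+1.
    by rewrite mem_index_iota ltnS (leq_trans (leq_subr _ _)).
  rewrite mul1n (bigD1_seq _ vin (iota_uniq _ _)) /=.
  rewrite subnKC // eqxx mul1n /F big1 ?addn0.
    by rewrite natrB // mulrBl.
  move=> v /negP nv; case: eqP => // h; case: nv.
  by rewrite h addKn.
rewrite natrM; congr (2 * _).
rewrite big_ltn // natrD; congr (_ + _).
  by rewrite mul0r; have -> : dist_int (0 : R) <= e;
    [apply/dist_intP; exists 0; rewrite addr0 normr0|rewrite muln1].
rewrite natr_sum; apply: eq_bigr => v _.
by rewrite natrM near.
Qed.

(** Evaluate the previous identity at [x = 0] and [e = 0], where all [N (N - 1)] ordered pairs are
    close. *)
Lemma sum_repr_pairs (N V : nat) :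
  (forall i j, (0 < i <= j)%N -> (j <= N)%N -> (a i <= a j <= V)%N) ->
  2 * ((repr_pairs a N 0)%:R + \sum_(1 <= v < V.+1) (repr_pairs a N v)%:R) =
    N%:R * (N%:R - 1) :> R.
Proof.
move=> amono; have := @close_pairs_repr 0 0 N V (lexx (0 : R)) amono.
have d0 (y : R) : dist_int (y * 0) <= 0.
  by apply/dist_intP; exists 0; rewrite mulr0 addr0 normr0.
have -> : step_fun (near_set (0 : R) 0) (index_iota 1 V.+1) (fun v => (repr_pairs a N v)%:R) 0 =
    \sum_(1 <= v < V.+1) (repr_pairs a N v)%:R :> R.
  rewrite /step_fun; apply: eq_bigr => v _; rewrite indicE mem_set ?mulr1 //.
  by rewrite /near_set /= addr0.
move=> <-; rewrite close_pairs_sum.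
case: N {amono} => [|N]; first by rewrite big_geq // mul0r.
have -> : N.+1%:R - 1 = N%:R :> R by rewrite -natr1 addrK.
rewrite -natrM; congr (_%:R).
transitivity (\sum_(1 <= i < N.+2) N)%N; last by rewrite sum_nat_const_nat subn1.
apply: eq_big_nat => i iN.
have S1 : (\sum_(1 <= j < N.+2) (i == j) = 1)%N.
  rewrite (bigD1_seq i) ?mem_index_iota ?iota_uniq //= eqxx big1 // => j.
  by rewrite eq_sym => /negbTE->.
apply: (@addIn (\sum_(1 <= j < N.+2) (i == j))%N); rewrite -big_split /= S1.
rewrite (eq_bigr (fun=> 1)%N); last first.
  by move=> j _; rewrite -mulrBl d0 andbT; case: (i == j).
by rewrite sum_nat_const_nat muln1 subn1 addn1.
Qed.

End close_pairs.

(** * Interpolation along a subsequence *)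

Section sandwich.
Variable R : realType.

(** For [M j <= N < M (j + 1)], monotonicity compares the count at [N] with those at the two ends,
    the ratio of the ends being absorbed by a slightly larger or smaller parameter. Rational
    parameters suffice, which keeps the exceptional sets countable in number. *)
Lemma cvg_sandwich (c : R -> nat -> nat) (M : nat -> nat) :
  (forall e e' N N', (N <= N')%N -> e <= e' -> (c e N <= c e' N')%N) ->
  (forall j, (0 < M j)%N) -> (forall N, exists j, (N < M j)%N) ->
  ((M j.+1)%:R / (M j)%:R : R) @[j --> \oo] --> (1 : R) ->
  (forall q : rat, 0 < (ratr q : R) ->
     ((M j)%:R^-1 * (c (ratr q / (M j)%:R) (M j))%:R : R) @[j --> \oo] --> (2 * ratr q : R)) ->
  forall s : R, 0 < s -> (N%:R^-1 * (c (s / N%:R) N)%:R : R) @[N --> \oo] --> 2 * s.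
Proof.
move=> cmono M0 Munb Mratio Hq s s0.
pose A q j : R := (M j)%:R^-1 * (c (q / (M j)%:R) (M j))%:R.
pose rho j : R := (M j.+1)%:R / (M j)%:R.
have MR0 j : 0 < (M j)%:R :> R by rewrite ltr0n.
have bracket J : exists N0, forall N, (N0 <= N)%N ->
    exists j, [/\ (J <= j)%N, (M j <= N)%N & (N < M j.+1)%N].
  exists (M J) => N MN.
  have ex : exists j, (N < M (J + j).+1)%N.
    have [j Hj] := Munb (maxn N (\max_(i < J.+1) M i)).
    move: Hj; rewrite gtn_max => /andP[Nj mj].
    have Jj : (J < j)%N.
      rewrite ltnNge; apply/negP => jJ; move: mj; rewrite ltnNge => /negP; apply.
      by apply: (leq_bigmax (F := fun i : 'I_J.+1 => M i) (Ordinal (jJ : (j < J.+1)%N))).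
    by exists (j - J.+1)%N; rewrite -addSn subnKC.
  case: (ex_minnP ex) => j Nj minj; exists (J + j)%N; split => //; first exact: leq_addr.
  case: j Nj minj => [|j] Nj minj; first by rewrite addn0.
  rewrite leqNgt addnS; apply/negP => /minj; by rewrite ltnn.
apply/cvgrPdist_le => e e0.
have e4 : 0 < e / 4 by lra.
(* [q1] lies in [(s, s + e / 4)] and [q2] just below [s], so the limits [2 q1] and [2 q2] are within
   [e / 2] of [2 s]. *)
have [q1 q1P] := rat_in_itvoo (ltr_pwDr e4 (lexx s) : s < s + e / 4).
have l1 : Num.max (s / 2) (s - e / 4) < s by rewrite gt_max; apply/andP; split; lra.
have [q2 q2P] := rat_in_itvoo l1.
move: q1P q2P; rewrite !in_itv /= => /andP[sq1 q1s] /andP[+ q2s].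
rewrite gt_max => /andP[q20 q2e].
have q1p : 0 < (ratr q1 : R) by lra.
have q2p : 0 < (ratr q2 : R) by lra.
have U : \forall j \near \oo, rho j * A (ratr q1) j.+1 < 2 * s + e.
  have h : rho j * A (ratr q1) j.+1 @[j --> \oo] --> (1 * (2 * ratr q1) : R).
    apply: cvgM => //.
    by have := Hq q1 q1p; rewrite -(cvg_shiftS (A (ratr q1))).
  by apply: (cvgr_lt _ h); lra.
have U' : \forall j \near \oo, s * rho j < ratr q1.
  have h : s * rho j @[j --> \oo] --> (s * 1 : R) by apply: cvgM => //; exact: cvg_cst.
  by apply: (cvgr_lt _ h); lra.
have V : \forall j \near \oo, 2 * s - e < (rho j)^-1 * A (ratr q2) j.
  have h : (rho j)^-1 * A (ratr q2) j @[j --> \oo] --> (1^-1 * (2 * ratr q2) : R).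
    by apply: cvgM; [apply: cvgV|exact: Hq].
  by apply: (cvgr_gt _ h); rewrite invr1; lra.
have V' : \forall j \near \oo, ratr q2 * rho j < s.
  have h : ratr q2 * rho j @[j --> \oo] --> (ratr q2 * 1 : R) by apply: cvgM => //; exact: cvg_cst.
  by apply: (cvgr_lt _ h); lra.
have [J _ HJ] : \forall j \near \oo, [/\ rho j * A (ratr q1) j.+1 < 2 * s + e,
   s * rho j < ratr q1, 2 * s - e < (rho j)^-1 * A (ratr q2) j & ratr q2 * rho j < s].
  by near=> j; split; near: j.
have [N0 HN0] := bracket J.
exists N0 => // N /HN0[j [Jj MN NM]].
have [{}U {}U' {}V {}V'] := HJ j Jj.
have NR0 : 0 < N%:R :> R by rewrite ltr0n (leq_trans (M0 j)).
have MN' : (M j)%:R <= N%:R :> R by rewrite ler_nat.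
have NM' : N%:R <= (M j.+1)%:R :> R by rewrite ler_nat ltnW.
have up : N%:R^-1 * (c (s / N%:R) N)%:R <= rho j * A (ratr q1) j.+1.
  have -> : rho j * A (ratr q1) j.+1 =
      (M j)%:R^-1 * (c (ratr q1 / (M j.+1)%:R) (M j.+1))%:R.
    by rewrite /rho /A; field; rewrite !gt_eqF.
  apply: ler_pM; rewrite ?invr_ge0 //; first by rewrite lef_pV2 ?posrE.
  rewrite ler_nat; apply: cmono; first exact: ltnW.
  rewrite ler_pdivrMr // mulrAC ler_pdivlMr //.
  move: U'; rewrite /rho mulrA ltr_pdivrMr // => /ltW/le_trans; apply.
  by rewrite ler_pM2l.
have low : (rho j)^-1 * A (ratr q2) j <= N%:R^-1 * (c (s / N%:R) N)%:R.
  have -> : (rho j)^-1 * A (ratr q2) j =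
      (M j.+1)%:R^-1 * (c (ratr q2 / (M j)%:R) (M j))%:R.
    by rewrite /rho /A; field; rewrite !gt_eqF.
  apply: ler_pM; rewrite ?invr_ge0 //; first by rewrite lef_pV2 ?posrE.
  rewrite ler_nat; apply: cmono => //.
  rewrite ler_pdivrMr // mulrAC ler_pdivlMr //.
  move: V'; rewrite /rho mulrA ltr_pdivrMr // => /ltW; apply: le_trans.
  by rewrite ler_pM2l.
move: U V up low; clear.
move: (rho j * _) (_ * A (ratr q2) j) (N%:R^-1 * _) => u v w U V up low.
by rewrite ler_norml; apply/andP; split; lra.
Unshelve. all: by end_near.
Qed.

(* The growth is slow enough for consecutive ratios to tend to 1, and fast enough
   for the variances, of order [(ln N)^-4], to be summable. *)
Definition subexp (j : nat) : nat := (Num.truncn (expR (Num.sqrt (j%:R : R)))).+1.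

Lemma subexp_gt j : expR (Num.sqrt (j%:R : R)) < (subexp j)%:R.
Proof. exact: truncnS_gt. Qed.

Lemma subexp_le j : (subexp j)%:R <= expR (Num.sqrt (j%:R : R)) + 1.
Proof. by rewrite -natr1 lerD2r truncn_le // expR_ge0. Qed.

Lemma subexp_unbounded N : exists j, (N < subexp j)%N.
Proof.
exists (N ^ 2)%N; rewrite -(ltr_nat R); apply: le_lt_trans (subexp_gt _).
rewrite natrX sqrtr_sqr ger0_norm //.
by apply: le_trans (expR_ge1Dx _); rewrite lerDr.
Qed.

Lemma ln_subexp j : Num.sqrt (j%:R : R) <= ln (subexp j)%:R.
Proof.
rewrite -[leLHS]expRK ler_ln ?posrE ?expR_gt0 ?ltr0n //.
by rewrite ltW // subexp_gt.
Qed.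

Lemma ln_subexp4 j : (j%:R : R) ^+ 2 <= ln ((subexp j)%:R : R) ^+ 4.
Proof.
rewrite -[X in X ^+ 2](sqr_sqrtr (ler0n R j)) -exprM.
by apply: lerXn2r; rewrite ?nnegrE ?sqrtr_ge0 ?ln_subexp // ln_ge0 // ler1n.
Qed.

Lemma cvg_inv_sqrt : ((Num.sqrt (j%:R : R))^-1 : R) @[j --> \oo] --> (0 : R).
Proof.
apply/cvgrPdist_le => e e0.
exists (Num.truncn (e^-1 ^+ 2)).+1 => // j je.
rewrite sub0r normrN ger0_norm ?invr_ge0 ?sqrtr_ge0 //.
have ej : e^-1 ^+ 2 <= j%:R.
  by apply: le_trans (ltW (truncnS_gt _)) _; rewrite ler_nat.
have ei : 0 < e^-1 by rewrite invr_gt0.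
have es : e^-1 <= Num.sqrt j%:R.
  by rewrite -[leLHS]ger0_norm ?(ltW ei) // -sqrtr_sqr ler_wsqrtr.
rewrite -[leRHS]invrK lef_pV2 ?posrE //.
exact: lt_le_trans es.
Qed.

(** With [u = 1 / sqrt j], [sqrt (j + 1) <= sqrt j + u], and the unit lost in rounding is at most
    [u] times [subexp j]; hence the ratio lies between 1 and [exp u + u]. *)
Lemma cvg_subexp_ratio : ((subexp j.+1)%:R / (subexp j)%:R : R) @[j --> \oo] --> (1 : R).
Proof.
pose u j : R := (Num.sqrt (j%:R : R))^-1.
apply: (@squeeze_cvgr _ _ _ _ (fun=> 1 : R) (fun j => expR (u j) + u j)).
- exists 1%N => // j /= j1.
  have s0 : 0 < Num.sqrt (j%:R : R) by rewrite sqrtr_gt0 ltr0n.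
  have M0 : 0 < (subexp j)%:R :> R by rewrite ltr0n.
  have s01 : Num.sqrt (j%:R : R) <= Num.sqrt (j.+1%:R : R) by rewrite ler_wsqrtr // ler_nat.
  apply/andP; split.
    rewrite ler_pdivlMr // mul1r ler_nat ltnS.
    by apply: le_truncn; rewrite ler_expR.
  rewrite ler_pdivrMr //; apply: le_trans (subexp_le _) _.
  have e1 : expR (Num.sqrt (j%:R : R)) <= (subexp j)%:R := ltW (subexp_gt j).
  have u0 : 0 < u j by rewrite invr_gt0.
  rewrite mulrDl; apply: lerD.
    apply: le_trans (_ : expR (u j) * expR (Num.sqrt j%:R) <= _); last first.
      by rewrite ler_wpM2l ?expR_ge0.
    rewrite -expRD ler_expR.
    have q1 : Num.sqrt (j%:R : R) ^+ 2 = j%:R by rewrite sqr_sqrtr.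
    have q2 : Num.sqrt (j.+1%:R : R) ^+ 2 = j%:R + 1 by rewrite sqr_sqrtr // natr1.
    have uE : u j * Num.sqrt j%:R = 1 by rewrite mulVf ?gt_eqF.
    move: s0 s01 q1 q2 uE u0; clear.
    move: (j%:R : R) (Num.sqrt (j%:R : R)) (Num.sqrt (j.+1%:R : R)) (u j).
    move=> z x y w x0 xy xz yz wx w0.
    have : (y - x) * (y + x) = w * x by rewrite wx -subr_sqr xz yz addrAC subrr add0r.
    nra.
  have s1 : Num.sqrt (j%:R : R) <= (subexp j)%:R.
    by apply: le_trans e1; apply: le_trans (expR_ge1Dx _); rewrite lerDr.
  by rewrite /u ler_pdivlMl // mulr1.
- exact: cvg_cst.
- have h : expR (u j) + u j @[j --> \oo] --> (expR 0 + 0 : R).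
    apply: cvgD; last exact: cvg_inv_sqrt.
    apply: continuous_cvg; last exact: cvg_inv_sqrt.
    exact: continuous_expR.
  by rewrite expR0 addr0 in h.
Qed.

End sandwich.

(** * Almost sure convergence *)

Section ae_summable.
Context d (T : measurableType d) (R : realType) (mu : {measure set T -> \bar R}).

(** By monotone convergence the sum of all [F j] is integrable, hence finite almost everywhere, and
    the terms of a convergent series tend to 0. *)
Lemma ae_cvg0_summable (D : set T) (F : nat -> T -> R) (b : R) : measurable D ->
  (forall j, measurable_fun D (F j)) -> (forall j x, 0 <= F j x) ->
  (forall n, \sum_(0 <= j < n) (\int[mu]_(x in D) (F j x)%:E) <= b%:E)%E ->
  mu.-negligible (D `&` [set x | ~ (F j x @[j --> \oo] --> (0 : R))]).
Proof.
move=> mD mF F0 Fb.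
pose g x := (\sum_(0 <= j <oo) (F j x)%:E)%E.
have F0e j x : D x -> (0 <= (F j x)%:E)%E by rewrite lee_fin.
have mFe j : measurable_fun D (fun x => (F j x)%:E) by exact/measurable_EFinP.
have g0 x : (0 <= g x)%E by apply: nneseries_ge0 => j _ _; rewrite lee_fin.
have mg : measurable_fun D g.
  by apply: ge0_emeasurable_sum => [j x Dx _|j _]; [exact: F0e|exact: mFe].
have gb : (\int[mu]_(x in D) g x <= b%:E)%E.
  rewrite /g integral_nneseries //; apply: lime_le.
    by apply: is_cvg_nneseries => j _ _; apply: integral_ge0 => x Dx; exact: F0e.
  by apply: nearW => n; exact: Fb.
have ig : mu.-integrable D g.
  apply/integrableP; split => //.
  under eq_integral do rewrite gee0_abs //.
  by apply: le_lt_trans gb _; rewrite ltry.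
have [N [mN N0 AN]] := integrable_ae mD ig.
exists N; split => // x [Dx] ncvg; apply: AN => /= gfin; apply: ncvg.
have {}gfin := gfin Dx.
apply: cvg_series_cvg_0.
apply: nondecreasing_is_cvgn.
  by apply/nondecreasing_seqP => n; rewrite /series /= big_nat_recr //= lerDl.
exists (fine (g x)) => _ [n _ <-].
rewrite -lee_fin fineK // /series /= -sumEFin.
by apply: nneseries_lim_ge => j _ _; rewrite lee_fin.
Qed.

Lemma integral_sqrZ (D : set T) (f : T -> R) (k : R) : measurable D ->
  measurable_fun D f ->
  (\int[mu]_(x in D) ((k * f x) ^+ 2)%:E = (k ^+ 2)%:E * \int[mu]_(x in D) (f x ^+ 2)%:E)%E.
Proof.
move=> mD mf; under eq_integral do rewrite exprMn EFinM.
rewrite ge0_integralZl_EFin ?sqr_ge0 //.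
- by move=> x _; rewrite lee_fin sqr_ge0.
- by apply/measurable_EFinP; exact: measurable_funX.
Qed.

End ae_summable.

Lemma sum_inv_sqr_le (R : realType) (n : nat) :
  \sum_(0 <= j < n) (j.+1%:R ^+ 2)^-1 <= 2 :> R.
Proof.
(* A stronger bound with a telescoping defect, for the induction to go through. *)
have H : \sum_(0 <= j < n) (j.+1%:R ^+ 2)^-1 <= 2 - 2 / n.+1%:R :> R.
  elim: n => [|n IH]; first by rewrite big_nil divr1 subrr.
  rewrite big_nat_recr //=; apply: le_trans (lerD IH (lexx _)) _.
  have n0 : 0 <= n%:R :> R by [].
  rewrite -[n.+2%:R]natr1 -[n.+1%:R]natr1; move: n0; move: (n%:R : R) => x x0.
  have -> : 2 - 2 / (x + 1) + ((x + 1) ^+ 2)^-1 =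
     2 - 2 / (x + 1 + 1) - x / ((x + 1) ^+ 2 * (x + 1 + 1)).
    by field; rewrite !gt_eqF //; lra.
  by rewrite gerBl divr_ge0 // mulr_ge0 ?sqr_ge0 //; lra.
by apply: le_trans H _; rewrite gerBl divr_ge0.
Qed.

(** * Convergence along the subsequence on the unit interval *)

Section criterion.
Variables (R : realType) (a : nat -> nat).
Notation mu := (@lebesgue_measure R).
Notation I01 := (`[0%R, 1%R[%classic : set R).

(** The fluctuation of the pair correlation: the contribution of nonzero differences minus its
    mean. *)
Definition centered (q : R) (N : nat) (x : R) : R :=
  2 / N%:R * (step_fun (near_set (q / N%:R) 0) (index_iota 1 (a N).+1)
      (fun v => (repr_pairs a N v)%:R : R) x -
    2 * (q / N%:R) * \sum_(1 <= v < (a N).+1) (repr_pairs a N v)%:R).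

Hypothesis amono : forall i j, (0 < i <= j)%N -> (a i <= a j)%N.

(** By [sum_repr_pairs] the mean is explicit. What remains is the pairs of difference 0 and the
    [2 q / N] from having [N (N - 1)] pairs instead of [N ^ 2]. *)
Lemma pair_correlation_centered (q x : R) (N : nat) : (0 < N)%N ->
  0 <= q / N%:R <= 1 / 2 ->
  `|pair_correlation a q x N - 2 * q - centered q N x| <=
    2 * (repr_pairs a N 0)%:R / N%:R + 2 * q / N%:R.
Proof.
move=> N0 /andP[e0 e1]; have NR0 : 0 < N%:R :> R by rewrite ltr0n.
have am i j : (0 < i <= j)%N -> (j <= N)%N -> (a i <= a j <= a N)%N.
  move=> /andP[i0 ij] jN; rewrite !amono ?i0 //.
  by rewrite jN (leq_trans i0 ij).
have T := sum_repr_pairs R am.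
have -> : pair_correlation a q x N = N%:R^-1 * (close_pairs a (q / N%:R) x N)%:R by [].
rewrite (close_pairs_repr x e0 am) /centered.
move: T e0 e1.
have : q = (q / N%:R) * N%:R by rewrite divfK // gt_eqF.
have : 0 <= (repr_pairs a N 0)%:R :> R by [].
move: (step_fun _ _ _ _) (\sum_(1 <= v < _) _) ((repr_pairs a N 0)%:R : R) => Y P r r0.
move: (q / N%:R) NR0 => e; move: (N%:R : R) => n n0 qE T e0 e1.
have nN : n != 0 by rewrite gt_eqF.
have -> : n^-1 * (2 * (r + Y)) - 2 * q - 2 / n * (Y - 2 * e * P) =
   2 * r / n * (1 - 2 * e) - 2 * q / n + 2 * e / n * (2 * (r + P) - n * (n - 1)).
  by rewrite qE; field.
rewrite T subrr mulr0 addr0.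
have A : 0 <= 2 * r / n by rewrite !mulr_ge0 // invr_ge0 ltW.
have q0 : 0 <= q by rewrite qE mulr_ge0 // ltW.
have B : 0 <= 2 * q / n by rewrite !mulr_ge0 // invr_ge0 ltW.
by rewrite ler_norml; apply/andP; split; nra.
Qed.

Lemma integral_centered_le (q B C : R) (N : nat) : (0 < N)%N -> 0 < ln (N%:R : R) ->
  0 <= q / N%:R <= 1 / 2 -> (forall v, (repr_pairs a N v)%:R <= B) ->
  B ^+ 2 * ((a N)%:R * harm R (a N)) * ln N%:R ^+ 4 <= C * N%:R ^+ 3 ->
  (\int[mu]_(x in I01) (centered q N x ^+ 2)%:E <= (16 * q * C / ln N%:R ^+ 4)%:E)%E.
Proof.
move=> N0 l0 e01 rB BC; have NR0 : 0 < N%:R :> R by rewrite ltr0n.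
have mI : measurable I01 by exact: measurable_itv.
have mf : measurable_fun I01 (fun x : R => step_fun (near_set (q / N%:R) 0)
     (index_iota 1 (a N).+1) (fun v => (repr_pairs a N v)%:R : R) x -
    2 * (q / N%:R) * \sum_(1 <= v < (a N).+1) (repr_pairs a N v)%:R).
  apply: measurable_funB; last exact: measurable_cst.
  by apply: measurable_step_fun => v; exact: measurable_near_set.
have -> := integral_sqrZ mu (2 / N%:R) mI mf.
have r01 v : 0 <= ((repr_pairs a N v)%:R : R) <= B by rewrite rB ler0n.
have := variance_near (a N) e01 r01.
set J := (\int[_]_(x in _) _)%E => JB.
apply: (@le_trans _ _ (((2 / N%:R) ^+ 2)%:E *
   (4 * (q / N%:R) * B ^+ 2 * ((a N)%:R * harm R (a N)))%:E)%E).
  by rewrite lee_pmul2l ?lte_fin ?exprn_gt0 // divr_gt0.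
rewrite -EFinM lee_fin ler_pdivlMr ?exprn_gt0 //.
have q0 : 0 <= q by move/andP: e01 => [e0 _]; rewrite -(divfK (lt0r_neq0 NR0) q) mulr_ge0.
have -> : (2 / N%:R) ^+ 2 * (4 * (q / N%:R) * B ^+ 2 * ((a N)%:R * harm R (a N))) *
    ln N%:R ^+ 4 = 16 * q / N%:R ^+ 3 * (B ^+ 2 * ((a N)%:R * harm R (a N)) * ln N%:R ^+ 4).
  by field; rewrite gt_eqF.
have -> : 16 * q * C = 16 * q / N%:R ^+ 3 * (C * N%:R ^+ 3).
  by field; rewrite gt_eqF.
apply: ler_wpM2l => //; rewrite divr_ge0 ?exprn_ge0 // mulr_ge0 //.
Qed.

Lemma pair_correlation_periodic (s : R) (N : nat) (x : R) :
  pair_correlation a s (x + 1) N = pair_correlation a s x N.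
Proof.
rewrite /pair_correlation; congr (_ * _%:R); apply: eq_card => p; rewrite !inE.
congr [&& _, _, _ & _ <= _].
have := dist_int_addz ((a p.1)%:R * x - (a p.2)%:R * x) ((a p.1)%:Z - (a p.2)%:Z).
rewrite rmorphB /= -!pmulrn => <-; congr dist_int; ring.
Qed.

Variables (C : R) (N0 : nat).
Hypothesis C0 : 0 <= C.
Hypothesis bound : forall N, (N0 <= N)%N -> exists B : R, [/\ 0 <= B,
    forall v, (repr_pairs a N v)%:R <= B,
    B * ln N%:R <= C * N%:R &
    B ^+ 2 * ((a N)%:R * harm R (a N)) * ln N%:R ^+ 4 <= C * N%:R ^+ 3].

Lemma subexp_large (q : R) : exists j0 : nat, (0 < j0)%N /\ forall j, (j0 <= j)%N ->
  [/\ (N0 <= subexp R j)%N, q / (subexp R j)%:R <= 1 / 2 &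
     0 < ln ((subexp R j)%:R : R)].
Proof.
pose k := maxn N0 (maxn 2 (Num.truncn (2 * q)).+1).
exists (k ^ 2)%N; split.
  by rewrite expn_gt0 /k; lia.
move=> j kj.
have kM : k%:R < (subexp R j)%:R :> R.
  apply: le_lt_trans (subexp_gt _ _).
  have kj' : (k ^ 2)%:R <= j%:R :> R by rewrite ler_nat.
  apply: le_trans (_ : 1 + Num.sqrt j%:R <= _); last exact: expR_ge1Dx.
  apply: le_trans (_ : Num.sqrt j%:R <= _); last by rewrite lerDr.
  by rewrite -[leLHS]ger0_norm // -sqrtr_sqr ler_wsqrtr // -natrX.
have kM' := kM; rewrite ltr_nat in kM'.
have [k1 k2 k3] : [/\ (N0 <= k)%N, (2 <= k)%N & (Num.truncn (2 * q) < k)%N].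
  by rewrite /k !leq_max !leqnn !orbT.
split.
- exact: leq_trans k1 (ltnW kM').
- rewrite ler_pdivrMr ?ltr0n //.
  have : 2 * q < k%:R by apply: lt_le_trans (truncnS_gt _) _; rewrite ler_nat.
  move: kM; clear; move: (k%:R : R) ((subexp R j)%:R : R) => x y; lra.
- apply: ln_gt0; rewrite ltr1n; exact: leq_trans k2 (ltnW kM').
Qed.

(** The variances along the subsequence are summable, so the centered parts tend to 0 almost
    everywhere; the deterministic error is [O (1 / sqrt j)]. *)
Lemma ae_subexp (q : R) : 0 < q ->
  mu.-negligible (I01 `&` [set x |
    ~ (pair_correlation a q x (subexp R j) @[j --> \oo] --> 2 * q)]).
Proof.
move=> q0; have [j0 [j00 Hj]] := subexp_large q.
have mI : measurable I01 by exact: measurable_itv.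
pose M j := subexp R (j + j0).
have MR0 j : 0 < (M j)%:R :> R by rewrite ltr0n.
have e01 j : 0 <= q / (M j)%:R <= 1 / 2.
  have [_ h _] := Hj (j + j0)%N (leq_addl _ _).
  by rewrite h andbT divr_ge0 // ltW.
have l0 j : 0 < ln ((M j)%:R : R) by have [] := Hj (j + j0)%N (leq_addl _ _).
have bnd j := bound (let: And3 h _ _ := Hj (j + j0)%N (leq_addl _ _) in h).
pose F j x := centered q (M j) x ^+ 2.
have mF j : measurable_fun I01 (F j).
  apply: measurable_funX; apply: measurable_funM; first exact: measurable_cst.
  apply: measurable_funB; last exact: measurable_cst.
  by apply: measurable_step_fun => v; exact: measurable_near_set.
have Fsum n : (\sum_(0 <= j < n) (\int[mu]_(x in I01) (F j x)%:E) <= (16 * q * C * 2)%:E)%E.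
  apply: (@le_trans _ _ (\sum_(0 <= j < n) (16 * q * C * (j.+1%:R ^+ 2)^-1)%:E)%E).
    apply: lee_sum => j _.
    have [B [B0 rB _ BC]] := bnd j.
    apply: le_trans (integral_centered_le _ (l0 j) (e01 j) rB BC) _; first by [].
    rewrite lee_fin ler_wpM2l ?mulr_ge0 ?(ltW q0) // lef_pV2 ?posrE ?exprn_gt0 ?ltr0n //.
    apply: le_trans (ln_subexp4 R (j + j0)).
    (* The shift [j0 >= 1] gives [j + 1 <= j + j0]. *)
    by apply: lerXn2r; rewrite ?nnegrE // ler_nat -addn1 leq_add2l.
  rewrite sumEFin lee_fin -mulr_sumr ler_wpM2l ?sum_inv_sqr_le //.
  by rewrite !mulr_ge0 // ltW.
have := @ae_cvg0_summable _ _ R mu I01 F _ mI mF (fun j x => sqr_ge0 _) Fsum.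
apply: negligibleS => x [xI ncvg]; split => //= Fcvg; apply: ncvg.
rewrite -(cvg_shiftn j0).
pose u j : R := (Num.sqrt ((j + j0)%N%:R : R))^-1.
have ucvg : u j @[j --> \oo] --> (0 : R).
  by have := @cvg_inv_sqrt R; rewrite -(cvg_shiftn j0).
pose K : R := 2 * C + 2 * q.
have K0 : 0 < K by rewrite ltr_wpDl ?mulr_ge0 // mulr_gt0.
(* [B * ln N <= C * N] with [ln N >= sqrt (j + j0)] handles difference 0, which gives [2 C]; the
   term [2 q / N] gives [2 q]. *)
have main j : `|pair_correlation a q x (M j) - 2 * q - centered q (M j) x| <= K * u j.
  have [B [B0 rB BL _]] := bnd j.
  apply: le_trans (pair_correlation_centered _ _ (e01 j)) _; first by [].
  have s0 : 0 < Num.sqrt ((j + j0)%N%:R : R) by rewrite sqrtr_gt0 ltr0n addn_gt0 j00 orbT.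
  rewrite -mulrDl ler_pdivrMr // /u mulrAC ler_pdivlMr //.
  have sl := ln_subexp R (j + j0); rewrite -/(M j) in sl.
  have sM : Num.sqrt ((j + j0)%N%:R : R) <= (M j)%:R.
    apply: le_trans (ltW (subexp_gt _ _)).
    by apply: le_trans (expR_ge1Dx _); rewrite lerDr.
  have A : (repr_pairs a (M j) 0)%:R * Num.sqrt ((j + j0)%N%:R : R) <= C * (M j)%:R.
    apply: le_trans BL; apply: ler_pM => //; exact: ltW.
  have D : q * Num.sqrt ((j + j0)%N%:R : R) <= q * (M j)%:R by rewrite ler_pM2l.
  by rewrite /K !mulrDl -!mulrA !mul1r; do !apply: lerD.
apply/cvgrPdist_le => e e0.
have e2 : 0 < e / 2 by rewrite divr_gt0.
move/cvgrPdist_le : Fcvg => Fcvg; move/cvgrPdist_le : ucvg => ucvg.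
have [j1 _ H1] := Fcvg ((e / 2) ^+ 2) (exprn_gt0 2 e2).
have [j2 _ H2] := ucvg (e / 2 / K) (divr_gt0 e2 K0).
exists (maxn j1 j2) => // j; rewrite /= geq_max => /andP[jj1 jj2].
have := H1 j jj1; rewrite /= sub0r normrN /F normrX => h1.
have := H2 j jj2; rewrite /= sub0r normrN => h2.
have {}h1 : `|centered q (M j) x| <= e / 2.
  by rewrite -(ler_pXn2r (n := 2)) ?nnegrE ?(ltW e2).
have {}h2 : K * u j <= e / 2.
  by rewrite mulrC -ler_pdivlMr // (le_trans (ler_norm _)).
have := main j; rewrite -/(M j) distrC.
move: h1 h2; move: (pair_correlation _ _ _ _) (centered _ _ _) (K * u j) => p c w.
rewrite !ler_norml => /andP[h1 h1'] h2 /andP[h3 h4].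
by apply/andP; split; lra.
Qed.

End criterion.

(** * From the unit interval to the whole line *)

Section extension.
Variable R : realType.
Notation mu := (@lebesgue_measure R).
Notation I01 := (`[0%R, 1%R[%classic : set R).

Lemma periodic1_addz (A : set R) (k : int) (x : R) : periodic1 A -> A x -> A (x + k%:~R).
Proof.
move=> pA; have nat_case (n : nat) y : A y -> A (y + n%:R) /\ A (y - n%:R).
  elim: n y => [|n IH] y Ay; first by rewrite subr0 addr0.
  have [h1 h2] := IH y Ay; rewrite -natr1; split.
    by rewrite addrA; apply/(pA _).2.
  by apply/(pA _).1; rewrite opprD addrA subrK.
move=> Ax; case: (intP k) => [|n|n]; first by rewrite addr0.
  by rewrite -pmulrn; have [] := nat_case n.+1 x Ax.
by rewrite rmorphN /= -pmulrn; have [] := nat_case n.+1 x Ax.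
Qed.

Lemma negligible_shift (t : R) (A : set R) : mu.-negligible A ->
  mu.-negligible ((fun x : R => x + t) @^-1` A).
Proof.
move=> [N [mN N0 AN]]; exists ((fun x : R => x + t) @^-1` N); split.
- exact: measurable_preimage_shift.
- by rewrite -N0; exact: lebesgue_measure_shift.
- by move=> x; exact: AN.
Qed.

(** Every point of [A] is moved into [[0, 1[] by an integer translation, so [A] is covered by
    countably many null translates. *)
Lemma negligible_periodic1 (A : set R) : periodic1 A ->
  mu.-negligible (I01 `&` A) -> mu.-negligible A.
Proof.
move=> pA A0.
pose k n : int := if unpickle n is Some i then i else 0.
have cov0 : mu.-negligible (\bigcup_n ((fun x : R => x + (k n)%:~R) @^-1` (I01 `&` A))).
  by apply: negligible_bigcup => n; exact: negligible_shift.
apply: negligibleS cov0 => x Ax; exists (pickle (- Num.floor x)) => //=.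
rewrite /k pickleK; split; last exact: periodic1_addz.
have /andP[h1 h2] := mem_rg1_floor x.
by rewrite /= in_itv /= rmorphN /= subr_ge0 h1 /= ltrBlDl.
Qed.

Lemma poissonian_criterion (a : nat -> nat) (C : R) (N0 : nat) :
  (forall i j, (0 < i <= j)%N -> (a i <= a j)%N) -> 0 <= C ->
  (forall N, (N0 <= N)%N -> exists B : R, [/\ 0 <= B,
    forall v, (repr_pairs a N v)%:R <= B,
    B * ln N%:R <= C * N%:R &
    B ^+ 2 * ((a N)%:R * harm R (a N)) * ln N%:R ^+ 4 <= C * N%:R ^+ 3]) ->
  metric_poissonian_pair_correlation R a.
Proof.
move=> amono C0 bound.
pose bad (q : R) : set R := [set x |
   ~ (pair_correlation a q x (subexp R j) @[j --> \oo] --> 2 * q)].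
have bad0 (q : R) : 0 < q -> mu.-negligible (bad q).
  move=> q0; apply: negligible_periodic1.
    by move=> x; rewrite /bad /=; under eq_fun do rewrite pair_correlation_periodic.
  exact: (ae_subexp amono C0 bound q0).
(* Indices that decode to no rational give 0, for which [Bd] is empty. *)
pose q n : rat := if unpickle n is Some r then r else 0.
pose Bd n : set R := if 0 < (ratr (q n) : R) then bad (ratr (q n)) else set0.
have Bd0 : mu.-negligible (\bigcup_n Bd n).
  apply: negligible_bigcup => n; rewrite /Bd; case: ifPn => [/bad0 //|_].
  exact: negligible_set0.
apply: negligibleS Bd0 => x /= nx; apply: contrapT => nBd; apply: nx => s s0.
apply: (@cvg_sandwich R (fun e N => close_pairs a e x N) (subexp R)) => //.
- by move=> e e' N N' NN ee; exact: close_pairs_le.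
- exact: subexp_unbounded.
- exact: cvg_subexp_ratio.
- move=> r r0; apply: contrapT => ncvg; apply: nBd; exists (pickle r) => //.
  by rewrite /Bd /q pickleK r0.
Qed.

End extension.

Lemma n_log_pow_mono (R : realType) (K : R) (i j : nat) : 0 <= K -> (0 < i <= j)%N ->
  (n_log_pow K i <= n_log_pow K j)%N.
Proof.
move=> K0 /andP[i0 ij]; apply: le_truncn.
have i1 : 1 <= i%:R :> R by rewrite ler1n.
have ij' : i%:R <= j%:R :> R by rewrite ler_nat.
apply: ler_pM => //; first exact: powR_ge0.
apply: ge0_ler_powR; rewrite ?nnegrE ?ln_ge0 ?(le_trans i1) //.
by rewrite ler_ln ?posrE // (lt_le_trans ltr01) // (le_trans i1).
Qed.

Theorem corollary1p2 (R : realType) (K : R) (hK : 1571%:R / 100%:R <= K) :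
  metric_poissonian_pair_correlation R (n_log_pow K).
Proof.
have K11 : 11 <= K by lra.
have [C [N0 [C0 bound]]] := repr_bound K11.
apply: (poissonian_criterion _ C0 bound) => i j.
by apply: n_log_pow_mono; lra.
Qed.
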